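(* Let $X,Y$ be computable Banach spaces. Then $\mathsf{IMT}_{X,Y}\le_W\mathsf{C_{\mathbb N}}\equiv_W\mathsf{IMT}_{\ell^2,\ell^2}$.
   Context: A represented space is a pair $(X,\delta_X)$ with $\delta_X:\subseteq\mathbb N^{\mathbb N}\to X$ a partial surjection. For a partial multi-valued map $f:\subseteq X\rightrightarrows Y$ between represented spaces, a realizer of $f$ is a partial function $F:\subseteq\mathbb N^{\mathbb N}\to\mathbb N^{\mathbb N}$ with $\delta_Y(F(p))\in f(\delta_X(p))$ for all $p\in\mathrm{dom}(f\circ\delta_X)$. We write $f\le_W g$ (Weihrauch reducibility) if there are computable partial functions $H,K:\subseteq\mathbb N^{\mathbb N}\to\mathbb N^{\mathbb N}$ such that for every realizer $G$ of $g$ the function $p\mapsto H\langle p,G(K(p))\rangle$ is a realizer of $f$, where $\langle\cdot,\cdot\rangle$ is a standard computable pairing on $\mathbb N^{\mathbb N}$. $\equiv_W$ is the induced equivalence. $\mathcal A_-(\mathbb N)$ is the set of subsets of $\mathbb N$, where $p$ names $A$ iff $\mathbb N\setminus A=\{n:n+1\in\mathrm{range}(p)\}$; $\mathsf{C_{\mathbb N}}:\subseteq\mathcal A_-(\mathbb N)\rightrightarrows\mathbb N$, $A\mapsto A$, on non-empty $A$. A computable Banach space is a (real) Banach space together with a sequence whose linear span is dense, such that the induced metric space (with rational linear combinations as dense set) is a complete computable metric space; points are represented by the Cauchy representation $\delta_X$. $\mathcal C(X,Y)$ is the space of continuous $T:X\to Y$ with the standard function space representation $[\delta_X\to\delta_Y]$.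 $\ell^2$ is the standard computable Hilbert space of square-summable sequences. $\mathsf{IMT}_{X,Y}:\subseteq\mathcal C(X,Y)\to\mathcal C(Y,X)$, $T\mapsto T^{-1}$, defined on the linear bounded bijective $T$. *)

(* Defs.v *)
From Stdlib Require Import Reals Lra Lia List QArith Qreals Cantor.
Import ListNotations.
Open Scope R_scope.

Definition Baire := nat -> nat.

Definition bpair (p q : Baire) : Baire :=
  fun n => if Nat.even n then p (Nat.div2 n) else q (Nat.div2 n).

Fixpoint code_list (l : list nat) : nat :=
  match l with
  | [] => 0%nat
  | a :: l' => S (Cantor.to_nat (a, code_list l'))
  end.

Fixpoint decode_fuel (fuel n : nat) : list nat :=
  match fuel, n with
  | O, _ => []
  | _, O => []
  | S f, S k => let (a, b) := Cantor.of_nat k in a :: decode_fuel f b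
  end.
Definition decode_list (n : nat) : list nat := decode_fuel n n.

Definition prefix (p : Baire) (m : nat) : list nat := map p (seq 0 m).

Definition code_nw (n : nat) (w : list nat) : nat := Cantor.to_nat (n, code_list w).

Inductive recf : nat -> Type :=
| rZero (n : nat) : recf n
| rSucc : recf 1
| rProj (n i : nat) : recf n
| rComp (n m : nat) : recf m -> recfs n m -> recf n
| rPrec (n : nat) : recf n -> recf (S (S n)) -> recf (S n)
| rMin (n : nat) : recf (S n) -> recf n
with recfs : nat -> nat -> Type :=
| rNil (n : nat) : recfs n 0
| rCons (n m : nat) : recf n -> recfs n m -> recfs n (S m).

Inductive ev : forall n : nat, recf n -> list nat -> nat -> Prop :=
| evZero n v : ev n (rZero n) v 0
| evSucc x : ev 1 rSucc [x] (S x)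
| evProj n i v : ev n (rProj n i) v (nth i v 0%nat)
| evComp n m f gs v ws y :
    evs n m gs v ws -> ev m f ws y -> ev n (rComp n m f gs) v y
| evPrec0 n f g v y : ev n f v y -> ev (S n) (rPrec n f g) (0%nat :: v) y
| evPrecS n f g v k r y :
    ev (S n) (rPrec n f g) (k :: v) r ->
    ev (S (S n)) g (k :: r :: v) y ->
    ev (S n) (rPrec n f g) (S k :: v) y
| evMin n f v y :
    ev (S n) f (y :: v) 0 ->
    (forall z, (z < y)%nat -> exists w, ev (S n) f (z :: v) (S w)) ->
    ev n (rMin n f) v y
with evs : forall n m : nat, recfs n m -> list nat -> list nat -> Prop :=
| evsNil n v : evs n 0 (rNil n) v []
| evsCons n m f fs v y ys :
    ev n f v y -> evs n m fs v ys -> evs n (S m) (rCons n m f fs) v (y :: ys).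

Definition total_recursive (a : nat -> nat) : Prop :=
  exists f : recf 1, forall x, ev 1 f [x] (a x).

(* partial (a priori multi-valued) maps given by their graph *)
Definition pfun := Baire -> Baire -> Prop.

Definition functional (F : pfun) : Prop :=
  forall p q q', F p q -> F p q' -> q = q'.

(* the standard numbering eta of the continuous partial functions on Baire
   space: eta_a(q)(n) = a(<n, q[0..m)>) - 1 for the least m with a(...) <> 0 *)
Definition eta (a : Baire) : pfun :=
  fun q r => forall n, exists m,
      a (code_nw n (prefix q m)) <> 0%nat /\
      (forall m', (m' < m)%nat -> a (code_nw n (prefix q m')) = 0%nat) /\
      r n = Nat.pred (a (code_nw n (prefix q m))).

Definition computable (F : pfun) : Prop :=
  exists a, total_recursive a /\ forall p q, F p q -> eta a p q.

Record RepSpace := { pts : Type; rep : Baire -> pts -> Prop }.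

(* partial multi-valued map f :⊆ A ⇉ B, given by its graph;
   dom f = {x | exists y, f x y} *)
Definition mvf (A B : RepSpace) := pts A -> pts B -> Prop.

Definition realizer {A B : RepSpace} (f : mvf A B) (F : pfun) : Prop :=
  functional F /\
  forall p x, rep A p x -> (exists y, f x y) ->
    (exists q, F p q) /\
    (forall q, F p q -> exists y, rep B q y /\ f x y).

Definition weih_le {A B C D : RepSpace} (f : mvf A B) (g : mvf C D) : Prop :=
  exists H K : pfun, computable H /\ computable K /\
    forall G : pfun, realizer g G ->
      realizer f (fun p r => exists k s, K p k /\ G k s /\ H (bpair p s) r).

Definition weih_eq {A B C D : RepSpace} (f : mvf A B) (g : mvf C D) : Prop :=
  weih_le f g /\ weih_le g f.

Definition RNat : RepSpace := {| pts := nat; rep := fun p n => p 0%nat = n |}.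

Definition RAminus : RepSpace :=
  {| pts := nat -> bool;
     rep := fun p A => forall n, A n = false <-> exists k, p k = S n |}.

Definition CN : mvf RAminus RNat :=
  fun A n => (exists m, A m = true) /\ A n = true.

Record NSpace := {
  vcar :> Type;
  vzero : vcar;
  vadd : vcar -> vcar -> vcar;
  vscal : R -> vcar -> vcar;
  vnorm : vcar -> R }.

Arguments vzero {_}. Arguments vadd {_}. Arguments vscal {_}. Arguments vnorm {_}.

Definition vdist {V : NSpace} (x y : V) : R := vnorm (vadd x (vscal (-1) y)).

Definition is_banach (V : NSpace) : Prop :=
  (forall x y z : V, vadd x (vadd y z) = vadd (vadd x y) z) /\
  (forall x y : V, vadd x y = vadd y x) /\
  (forall x : V, vadd vzero x = x) /\
  (forall x : V, vadd x (vscal (-1) x) = vzero) /\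
  (forall x : V, vscal 1 x = x) /\
  (forall a b (x : V), vscal a (vscal b x) = vscal (a * b) x) /\
  (forall a b (x : V), vscal (a + b) x = vadd (vscal a x) (vscal b x)) /\
  (forall a (x y : V), vscal a (vadd x y) = vadd (vscal a x) (vscal a y)) /\
  (forall x : V, vnorm x = 0 -> x = vzero) /\
  (forall a (x : V), vnorm (vscal a x) = Rabs a * vnorm x) /\
  (forall x y : V, vnorm (vadd x y) <= vnorm x + vnorm y) /\
  (forall u : nat -> V,
     (forall eps, eps > 0 -> exists N, forall m n, (m >= N)%nat -> (n >= N)%nat ->
        vdist (u m) (u n) < eps) ->
     exists x, forall eps, eps > 0 -> exists N, forall n, (n >= N)%nat ->
        vdist (u n) x < eps).

Record CBSpace := { cb_sp : NSpace; cb_e : nat -> cb_sp }.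

Fixpoint lincomb {V : NSpace} (e : nat -> V) (k : nat) (l : list R) : V :=
  match l with
  | [] => vzero
  | c :: l' => vadd (vscal c (e k)) (lincomb e (S k) l')
  end.

Definition nat_to_Q (k : nat) : Q :=
  let (a, b) := Cantor.of_nat k in
  Qmake (if Nat.even a then Z.of_nat (Nat.div2 a) else (- Z.of_nat (Nat.div2 (S a)))%Z)
        (Pos.of_succ_nat b).

Definition cb_alpha (X : CBSpace) (n : nat) : cb_sp X :=
  lincomb (cb_e X) 0 (map (fun k => Q2R (nat_to_Q k)) (decode_list n)).

Definition is_CBS (X : CBSpace) : Prop :=
  is_banach (cb_sp X) /\
  (forall (x : cb_sp X) eps, eps > 0 ->
     exists l : list R, vdist x (lincomb (cb_e X) 0 l) < eps) /\
  (exists b, total_recursive b /\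
     forall i j n,
       Rabs (vdist (cb_alpha X i) (cb_alpha X j)
             - Q2R (nat_to_Q (b (Cantor.to_nat (i, Cantor.to_nat (j, n))))))
       <= (/ 2) ^ n).

Definition cauchy_rep (X : CBSpace) (p : Baire) (x : cb_sp X) : Prop :=
  (forall i j, (i <= j)%nat -> vdist (cb_alpha X (p i)) (cb_alpha X (p j)) <= (/ 2) ^ i) /\
  (forall eps, eps > 0 -> exists N, forall n, (n >= N)%nat ->
     vdist (cb_alpha X (p n)) x < eps).

Definition RCB (X : CBSpace) : RepSpace := {| pts := cb_sp X; rep := cauchy_rep X |}.

(* C(X,Y) with [delta_X -> delta_Y]: p names T iff eta_p realizes T *)
Definition RCFun (X Y : CBSpace) : RepSpace :=
  {| pts := cb_sp X -> cb_sp Y;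
     rep := fun p T => forall q x, cauchy_rep X q x ->
              exists r, eta p q r /\ cauchy_rep Y r (T x) |}.

Definition lin_bounded_bij {X Y : CBSpace} (T : cb_sp X -> cb_sp Y) : Prop :=
  (forall x y, T (vadd x y) = vadd (T x) (T y)) /\
  (forall a x, T (vscal a x) = vscal a (T x)) /\
  (exists c, forall x, vnorm (T x) <= c * vnorm x) /\
  (forall x y, T x = T y -> x = y) /\
  (forall y, exists x, T x = y).

Definition IMT (X Y : CBSpace) : mvf (RCFun X Y) (RCFun Y X) :=
  fun T S => lin_bounded_bij T /\ forall y, T (S y) = y.

Definition sq_summable (x : nat -> R) : Prop :=
  exists M, forall N, sum_f_R0 (fun n => x n ^ 2) N <= M.

Definition l2car := { x : nat -> R | sq_summable x }.

Lemma sq_summable_zero : sq_summable (fun _ => 0).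
Proof.
  exists 0. intro N. induction N; simpl in *; lra.
Qed.

Lemma sum_scal_l (c : R) (f : nat -> R) N :
  sum_f_R0 (fun n => c * f n) N = c * sum_f_R0 f N.
Proof. induction N; simpl; [ring|rewrite IHN; ring]. Qed.

Lemma sq_summable_add x y : sq_summable x -> sq_summable y ->
  sq_summable (fun n => x n + y n).
Proof.
  intros [M1 H1] [M2 H2]. exists (2 * M1 + 2 * M2). intro N.
  apply Rle_trans with (sum_f_R0 (fun n => 2 * (x n ^ 2) + 2 * (y n ^ 2)) N).
  - apply sum_Rle. intros n _. pose proof (pow2_ge_0 (x n - y n)). simpl in *. nra.
  - rewrite plus_sum, !sum_scal_l. specialize (H1 N); specialize (H2 N). lra.
Qed.

Lemma sq_summable_scal a x : sq_summable x -> sq_summable (fun n => a * x n).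
Proof.
  intros [M H]. exists (a ^ 2 * M). intro N.
  replace (sum_f_R0 (fun n => (a * x n) ^ 2) N)
    with (a ^ 2 * sum_f_R0 (fun n => x n ^ 2) N).
  - specialize (H N). apply Rmult_le_compat_l; [apply pow2_ge_0|exact H].
  - rewrite <- sum_scal_l. apply sum_eq. intros; ring.
Qed.

Definition l2_zero : l2car := exist _ (fun _ => 0) sq_summable_zero.
Definition l2_add (x y : l2car) : l2car :=
  exist _ _ (sq_summable_add _ _ (proj2_sig x) (proj2_sig y)).
Definition l2_scal (a : R) (x : l2car) : l2car :=
  exist _ _ (sq_summable_scal a _ (proj2_sig x)).

Definition l2_partial (x : l2car) : R -> Prop :=
  fun r => exists N, r = sum_f_R0 (fun n => proj1_sig x n ^ 2) N.

Lemma l2_partial_bound x : bound (l2_partial x).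
Proof.
  destruct (proj2_sig x) as [M HM]. exists M. intros r [N ->]. apply HM.
Qed.

Lemma l2_partial_ne x : exists r, l2_partial x r.
Proof. eexists. exists 0%nat. reflexivity. Qed.

Definition l2_norm (x : l2car) : R :=
  sqrt (proj1_sig (completeness _ (l2_partial_bound x) (l2_partial_ne x))).

Definition l2_space : NSpace :=
  {| vcar := l2car; vzero := l2_zero; vadd := l2_add; vscal := l2_scal;
     vnorm := l2_norm |}.

Definition unit_seq (k : nat) : nat -> R := fun n => if Nat.eqb n k then 1 else 0.

Lemma sq_summable_unit k : sq_summable (unit_seq k).
Proof.
  exists 1. intro N.
  assert (H : forall N, sum_f_R0 (fun n => unit_seq k n ^ 2) N
                        = if Nat.leb k N then 1 else 0).
  { induction N0 as [|N0 IH].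
    - simpl. unfold unit_seq. destruct k; simpl; lra.
    - cbn [sum_f_R0]. rewrite IH. unfold unit_seq.
      destruct (Nat.eqb_spec (S N0) k) as [E|E];
      destruct (Nat.leb_spec k N0); destruct (Nat.leb_spec k (S N0)); try lia; lra. }
  rewrite H. destruct (Nat.leb k N); lra.
Qed.

Definition l2_basis (k : nat) : l2car := exist _ (unit_seq k) (sq_summable_unit k).

Definition l2 : CBSpace := {| cb_sp := l2_space; cb_e := l2_basis |}.

(* Main.v *)
(** Let [T] be a bounded linear bijection. Its inverse is bounded by the open mapping
    theorem, the set of [n] with [|x| <= n |T x|] for all [x] is co-enumerable from a name
    of [T], and any such [n] turns the search for [alpha_i] with [T alpha_i] close to [y]
    into a computation of [T^-1 y]; this is [IMT <= CN]. Conversely, from an enumeration of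
    the complement of [A] one follows a candidate for an element of [A] and passes to the
    next one whenever it is refuted. The diagonal operator on [l2] with entry [2^-(s+1)] at
    the stages [s] of refutation and [1] elsewhere is invertible, and an approximation up to
    [1] by a finite sequence of the preimage of [(2^-s)_s] bounds the last refutation. *)
Require Import Defs.
From Stdlib Require Import Reals Lra Lia List ZArith QArith Qreals Cantor PeanoNat Wf_nat.
From Stdlib Require Import FunctionalExtensionality ClassicalEpsilon ProofIrrelevance.
Import ListNotations.

(** * Recursive functions *)

Local Open Scope nat_scope.

(** Boundedness of the inverse by [n] is refutable because it suffices to test the dense sequence:
    each violation is a strict inequality of norms, visible from finitely many values of the name of
    [T]. That some bound exists rests on a category argument that gives no way to compute one; this
    single number is what choice has to supply. For the converse, the operator must be named before
    later refutations are known. So entry [s] depends on the first stages only and is positive in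
    either case: the operator is always an injective contraction, and only the boundedness of its
    inverse depends on the refutations being finite in number. The information therefore sits in the
    inverse alone, and it is read off at one fixed vector. The number of coordinates found depends
    on the name of the inverse; this does no harm, as choice is multi-valued. All evaluations of
    names use finite parts of them. In [eta] the value 0 means that more input is wanted, so a name
    cut off by zeros may stay silent but never answers wrongly. *)

Definition rec_fun (n : nat) (f : list nat -> nat) : Prop :=
  exists F : recf n, forall v, length v = n -> ev n F v (f v).

Lemma rec_fun_ext n f g :
  rec_fun n f -> (forall v, length v = n -> f v = g v) -> rec_fun n g.
Proof.
  intros [F HF] E. exists F. intros v Hv. rewrite <- E by exact Hv. now apply HF.
Qed.

Lemma rec_fun_proj n i : rec_fun n (fun v => nth i v 0).
Proof. exists (rProj n i). intros v _. constructor. Qed.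

Lemma rec_fun_zero n : rec_fun n (fun _ => 0).
Proof. exists (rZero n). intros v _. constructor. Qed.

Lemma rec_fun_comp1 n g f :
  rec_fun 1 g -> rec_fun n f -> rec_fun n (fun v => g [f v]).
Proof.
  intros [G HG] [F HF]. exists (rComp n 1 G (rCons n 0 F (rNil n))). intros v Hv.
  apply evComp with [f v].
  - repeat constructor. now apply HF.
  - now apply HG.
Qed.

Lemma rec_fun_comp2 n g f1 f2 :
  rec_fun 2 g -> rec_fun n f1 -> rec_fun n f2 -> rec_fun n (fun v => g [f1 v; f2 v]).
Proof.
  intros [G HG] [F1 HF1] [F2 HF2].
  exists (rComp n 2 G (rCons n 1 F1 (rCons n 0 F2 (rNil n)))). intros v Hv.
  apply evComp with [f1 v; f2 v].
  - repeat constructor; [now apply HF1 | now apply HF2].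
  - now apply HG.
Qed.

Lemma rec_fun_prec n f g :
  rec_fun n f -> rec_fun (S (S n)) g ->
  rec_fun (S n) (fun v => nat_rect (fun _ => nat) (f (tl v))
                            (fun k r => g (k :: r :: tl v)) (hd 0 v)).
Proof.
  intros [F HF] [G HG]. exists (rPrec n F G). intros [|x v] Hv; [discriminate|].
  injection Hv as Hv. cbn [tl hd]. induction x as [|x IH]; cbn [nat_rect].
  - apply evPrec0. now apply HF.
  - eapply evPrecS; [exact IH|]. apply HG. simpl. now rewrite Hv.
Qed.

(** The least zero [m v] is given in advance, so the search is total. It serves to invert the
    pairing function. *)
Lemma rec_fun_min n f m :
  rec_fun (S n) f ->
  (forall v, length v = n -> f (m v :: v) = 0 /\ forall z, z < m v -> f (z :: v) <> 0) ->
  rec_fun n m.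
Proof.
  intros [F HF] H. exists (rMin n F). intros v Hv. destruct (H v Hv) as [H0 Hlt].
  constructor.
  - rewrite <- H0. apply HF. simpl. now rewrite Hv.
  - intros z Hz. exists (Nat.pred (f (z :: v))). specialize (Hlt z Hz).
    replace (S _) with (f (z :: v)) by lia. apply HF. simpl. now rewrite Hv.
Qed.

Lemma rec_fun_succ n f : rec_fun n f -> rec_fun n (fun v => S (f v)).
Proof.
  intro Hf. apply (rec_fun_comp1 n (fun v => S (hd 0 v)) f); [|exact Hf].
  exists rSucc. intros [|x [|]] Hv; try discriminate. constructor.
Qed.

Lemma rec_fun_add2 : rec_fun 2 (fun v => nth 0 v 0 + nth 1 v 0).
Proof.
  eapply rec_fun_ext.
  - apply (rec_fun_prec 1 (fun v => nth 0 v 0) (fun v => S (nth 1 v 0))).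
    + apply rec_fun_proj.
    + apply rec_fun_succ, rec_fun_proj.
  - intros [|x [|y [|]]] Hv; try discriminate. cbn [hd tl nth].
    clear Hv. induction x as [|x IH]; cbn [nat_rect Nat.add]; [reflexivity|now rewrite IH].
Qed.

Lemma rec_fun_add n f g :
  rec_fun n f -> rec_fun n g -> rec_fun n (fun v => f v + g v).
Proof. intros Hf Hg. exact (rec_fun_comp2 n _ f g rec_fun_add2 Hf Hg). Qed.

Lemma rec_fun_pred1 : rec_fun 1 (fun v => Nat.pred (nth 0 v 0)).
Proof.
  eapply rec_fun_ext.
  - apply (rec_fun_prec 0 (fun _ => 0) (fun v => nth 0 v 0)).
    + apply rec_fun_zero.
    + apply rec_fun_proj.
  - intros [|[|x] [|]] Hv; try discriminate; reflexivity.
Qed.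

Lemma rec_fun_sub n f g :
  rec_fun n f -> rec_fun n g -> rec_fun n (fun v => f v - g v).
Proof.
  intros Hf Hg.
  (* Primitive recursion runs on the first argument, which here is the number of predecessors to
     take; hence the exchanged order. *)
  refine (rec_fun_comp2 n (fun v => nth 1 v 0 - nth 0 v 0) g f _ Hg Hf).
  clear f g Hf Hg n.
  eapply rec_fun_ext.
  - apply (rec_fun_prec 1 (fun v => nth 0 v 0) (fun v => Nat.pred (nth 1 v 0))).
    + apply rec_fun_proj.
    + exact (rec_fun_comp1 3 _ _ rec_fun_pred1 (rec_fun_proj 3 1)).
  - intros [|x [|y [|]]] Hv; try discriminate. cbn [hd tl nth].
    clear Hv. induction x as [|x IH]; cbn [nat_rect]; [lia|]. rewrite IH. lia.
Qed.

(** * The Cantor pairing function and its inverse *)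

Definition triangle (n : nat) : nat := nat_rec (fun _ => nat) 0 (fun i m => S i + m) n.

Lemma triangle_S n : triangle (S n) = S n + triangle n.
Proof. reflexivity. Qed.

Lemma triangle_le m n : m <= n -> triangle m <= triangle n.
Proof.
  induction 1; [lia|]. rewrite triangle_S. lia.
Qed.

(** [triangle] repeats the recursion inside [Cantor.to_nat], so this holds by conversion. *)
Lemma to_nat_triangle x y : to_nat (x, y) = y + triangle (y + x).
Proof. reflexivity. Qed.

Lemma rec_fun_triangle n f : rec_fun n f -> rec_fun n (fun v => triangle (f v)).
Proof.
  apply (rec_fun_comp1 n (fun v => triangle (hd 0 v))).
  eapply rec_fun_ext.
  - apply (rec_fun_prec 0 (fun _ => 0) (fun v => S (nth 0 v 0) + nth 1 v 0)).
    + apply rec_fun_zero.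
    + apply rec_fun_add; [apply rec_fun_succ|]; apply rec_fun_proj.
  - intros [|x [|]] Hv; try discriminate. reflexivity.
Qed.

Lemma rec_fun_to_nat n f g :
  rec_fun n f -> rec_fun n g -> rec_fun n (fun v => to_nat (f v, g v)).
Proof.
  intros Hf Hg. apply rec_fun_add; [exact Hg|].
  apply rec_fun_triangle. now apply rec_fun_add.
Qed.

#[local] Opaque Cantor.to_nat Cantor.of_nat.

Definition p1 (n : nat) : nat := fst (of_nat n).
Definition p2 (n : nat) : nat := snd (of_nat n).

Lemma p1_to_nat a b : p1 (to_nat (a, b)) = a.
Proof. unfold p1. now rewrite cancel_of_to. Qed.

Lemma p2_to_nat a b : p2 (to_nat (a, b)) = b.
Proof. unfold p2. now rewrite cancel_of_to. Qed.

Lemma to_nat_p n : to_nat (p1 n, p2 n) = n.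
Proof. unfold p1, p2. rewrite <- surjective_pairing. apply cancel_to_of. Qed.

(** The diagonal of [x] is the least [z] with [triangle (S z) > x]. Subtracting the triangular
    number below [x] then leaves [p2 x]. *)
Lemma rec_fun_diag n f : rec_fun n f -> rec_fun n (fun v => p1 (f v) + p2 (f v)).
Proof.
  apply (rec_fun_comp1 n (fun v => p1 (hd 0 v) + p2 (hd 0 v))).
  apply rec_fun_min with (f := fun v => S (nth 1 v 0) - triangle (S (nth 0 v 0))).
  - apply rec_fun_sub.
    + apply rec_fun_succ, rec_fun_proj.
    + apply rec_fun_triangle, rec_fun_succ, rec_fun_proj.
  - intros [|x [|]] Hv; try discriminate. cbn [hd nth].
    pose proof (to_nat_p x) as E. rewrite to_nat_triangle in E.
    rewrite (Nat.add_comm (p2 x) (p1 x)) in E. split.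
    + rewrite triangle_S. lia.
    + intros z Hz. pose proof (triangle_le (S z) (p1 x + p2 x) Hz). lia.
Qed.

Lemma rec_fun_p2 n f : rec_fun n f -> rec_fun n (fun v => p2 (f v)).
Proof.
  intro Hf. eapply rec_fun_ext.
  - apply rec_fun_sub; [exact Hf|]. apply rec_fun_triangle, rec_fun_diag, Hf.
  - intros v _. cbn beta. pose proof (to_nat_p (f v)) as E. rewrite to_nat_triangle in E.
    rewrite (Nat.add_comm (p2 _) (p1 _)) in E. lia.
Qed.

Lemma rec_fun_p1 n f : rec_fun n f -> rec_fun n (fun v => p1 (f v)).
Proof.
  intro Hf. eapply rec_fun_ext.
  - apply rec_fun_sub; [apply rec_fun_diag, Hf | apply rec_fun_p2, Hf].
  - intros v _. cbn beta. lia.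
Qed.

(** * Closure properties of total recursive functions *)

Lemma total_recursive_rec_fun f :
  total_recursive f <-> rec_fun 1 (fun v => f (nth 0 v 0)).
Proof.
  split; intros [F HF]; exists F.
  - intros [|x [|]] Hv; try discriminate. apply HF.
  - intro x. exact (HF [x] eq_refl).
Qed.

Lemma tr_id : total_recursive (fun x => x).
Proof. apply total_recursive_rec_fun, rec_fun_proj. Qed.

Lemma tr_comp f g :
  total_recursive f -> total_recursive g -> total_recursive (fun x => f (g x)).
Proof.
  rewrite !total_recursive_rec_fun. intros Hf Hg.
  exact (rec_fun_comp1 1 _ _ Hf Hg).
Qed.

Lemma tr_succ f : total_recursive f -> total_recursive (fun x => S (f x)).
Proof. rewrite !total_recursive_rec_fun. apply rec_fun_succ. Qed.

Lemma tr_const c : total_recursive (fun _ => c).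
Proof.
  induction c.
  - apply total_recursive_rec_fun, rec_fun_zero.
  - now apply tr_succ.
Qed.

Lemma tr_add f g :
  total_recursive f -> total_recursive g -> total_recursive (fun x => f x + g x).
Proof. rewrite !total_recursive_rec_fun. apply rec_fun_add. Qed.

Lemma tr_sub f g :
  total_recursive f -> total_recursive g -> total_recursive (fun x => f x - g x).
Proof. rewrite !total_recursive_rec_fun. apply rec_fun_sub. Qed.

Lemma tr_to_nat f g :
  total_recursive f -> total_recursive g -> total_recursive (fun x => to_nat (f x, g x)).
Proof. rewrite !total_recursive_rec_fun. apply rec_fun_to_nat. Qed.

Lemma tr_p1 f : total_recursive f -> total_recursive (fun x => p1 (f x)).
Proof. rewrite !total_recursive_rec_fun. apply rec_fun_p1. Qed.

Lemma tr_p2 f : total_recursive f -> total_recursive (fun x => p2 (f x)).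
Proof. rewrite !total_recursive_rec_fun. apply rec_fun_p2. Qed.

Lemma tr_ext f g : total_recursive f -> (forall x, f x = g x) -> total_recursive g.
Proof. intros [F HF] E. exists F. intro x. rewrite <- E. apply HF. Qed.

(** Read as a statement on families, [tr2 Q] says that [Q x] is recursive uniformly in [x];
    operators that take a function as argument need their closure lemmas in this form. *)
Definition tr2 (f : nat -> nat -> nat) : Prop :=
  total_recursive (fun z => f (p1 z) (p2 z)).

Definition tr3 (f : nat -> nat -> nat -> nat) : Prop :=
  total_recursive (fun z => f (p1 z) (p1 (p2 z)) (p2 (p2 z))).

Lemma tr2_app f g h :
  tr2 f -> total_recursive g -> total_recursive h ->
  total_recursive (fun x => f (g x) (h x)).
Proof.
  intros Hf Hg Hh. eapply tr_ext.
  - exact (tr_comp _ _ Hf (tr_to_nat _ _ Hg Hh)).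
  - intro x. cbn beta. now rewrite p1_to_nat, p2_to_nat.
Qed.

Lemma tr3_app f g h k :
  tr3 f -> total_recursive g -> total_recursive h -> total_recursive k ->
  total_recursive (fun x => f (g x) (h x) (k x)).
Proof.
  intros Hf Hg Hh Hk. eapply tr_ext.
  - exact (tr_comp _ _ Hf (tr_to_nat _ _ Hg (tr_to_nat _ _ Hh Hk))).
  - intro x. cbn beta. now rewrite p2_to_nat, !p1_to_nat, p2_to_nat.
Qed.

Lemma tr_nat_rect f g h :
  total_recursive f -> tr3 g -> total_recursive h ->
  total_recursive (fun x => nat_rect (fun _ => nat) (f x) (g x) (h x)).
Proof.
  unfold tr3. rewrite !total_recursive_rec_fun. intros Hf Hg Hh.
  eapply rec_fun_ext.
  - eapply rec_fun_comp2; [|exact Hh|apply (rec_fun_proj 1 0)].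
    apply (rec_fun_prec 1 (fun v => f (nth 0 v 0))
            (fun v => (fun z => g (p1 z) (p1 (p2 z)) (p2 (p2 z)))
                        (to_nat (nth 2 v 0, to_nat (nth 0 v 0, nth 1 v 0)))) Hf).
    apply (rec_fun_comp1 3 _
             (fun v => to_nat (nth 2 v 0, to_nat (nth 0 v 0, nth 1 v 0))) Hg).
    repeat apply rec_fun_to_nat; apply rec_fun_proj.
  - intros [|x [|]] Hv; try discriminate. cbn [nth hd tl].
    induction (h x) as [|n IH]; cbn [nat_rect]; [reflexivity|].
    rewrite IH, p2_to_nat, !p1_to_nat, p2_to_nat. reflexivity.
Qed.

Definition ifz (n a b : nat) : nat := match n with O => a | S _ => b end.

(* Redefined below as more closure lemmas become available. *)
Ltac tr_lemma := fail.

Ltac tr_tac :=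
  cbv beta;
  first
  [ apply tr_id | apply tr_const
  | match goal with
    | H : total_recursive ?f |- total_recursive ?f => exact H
    | H : total_recursive ?f |- total_recursive (fun x => ?f (@?g x)) =>
        apply (tr_comp f g H); tr_tac
    | H : tr2 ?f |- total_recursive (fun x => ?f (@?g x) (@?h x)) =>
        apply (tr2_app f g h H); tr_tac
    | H : tr3 ?f |- total_recursive (fun x => ?f (@?g x) (@?h x) (@?k x)) =>
        apply (tr3_app f g h k H); tr_tac
    end
  | progress unfold tr2, tr3; tr_tac
  | tr_lemma; tr_tac
  | apply tr_succ; tr_tac | apply tr_add; tr_tac | apply tr_sub; tr_tac
  | apply tr_to_nat; tr_tac | apply tr_p1; tr_tac | apply tr_p2; tr_tac
  | idtac ].

Lemma tr_ifz f g h :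
  total_recursive f -> total_recursive g -> total_recursive h ->
  total_recursive (fun x => ifz (f x) (g x) (h x)).
Proof.
  intros Hf Hg Hh. eapply tr_ext.
  - apply (tr_nat_rect g (fun x _ _ => h x) f); [exact Hg| |exact Hf]. tr_tac.
  - intro x. cbn beta. now destruct (f x).
Qed.

Lemma tr_mul f g :
  total_recursive f -> total_recursive g -> total_recursive (fun x => f x * g x).
Proof.
  intros Hf Hg. eapply tr_ext.
  - apply (tr_nat_rect (fun _ => 0) (fun x _ r => g x + r) f); tr_tac.
  - intro x. cbn beta. induction (f x); simpl; congruence.
Qed.

Lemma tr_pow f g :
  total_recursive f -> total_recursive g -> total_recursive (fun x => f x ^ g x).
Proof.
  intros Hf Hg. eapply tr_ext.
  - apply (tr_nat_rect (fun _ => 1) (fun x _ r => f x * r) g); tr_tac;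
    apply tr_mul; tr_tac.
  - intro x. cbn beta. induction (g x); simpl; congruence.
Qed.

Lemma tr_pred f : total_recursive f -> total_recursive (fun x => Nat.pred (f x)).
Proof.
  intro Hf. eapply tr_ext; [apply (tr_sub f (fun _ => 1)); tr_tac|].
  intro x. cbn beta. lia.
Qed.


Ltac tr_lemma ::=
  first [ apply tr_ifz | apply tr_mul | apply tr_pow | apply tr_pred ].

(** Bounded search. The value 0 is reserved for failure, so the tests searched below return
    successors. *)
Definition first_nz (Q : nat -> nat) (t : nat) : nat :=
  nat_rect (fun _ => nat) 0 (fun k r => ifz r (Q k) r) t.

Lemma tr_first_nz Q t :
  tr2 Q -> total_recursive t -> total_recursive (fun x => first_nz (Q x) (t x)).
Proof.
  intros HQ Ht. unfold first_nz.
  apply (tr_nat_rect (fun _ => 0) (fun x k r => ifz r (Q x k) r) t); tr_tac.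
Qed.

Lemma first_nz_sound Q t :
  first_nz Q t <> 0 ->
  exists k, k < t /\ first_nz Q t = Q k /\ forall k', k' < k -> Q k' = 0.
Proof.
  unfold first_nz. intro H.
  assert (G : (nat_rect (fun _ => nat) 0 (fun k r => ifz r (Q k) r) t = 0 /\
               forall k', k' < t -> Q k' = 0) \/
              exists k, k < t /\
               nat_rect (fun _ => nat) 0 (fun k r => ifz r (Q k) r) t = Q k /\
               Q k <> 0 /\ forall k', k' < k -> Q k' = 0).
  { clear H. induction t as [|t [[E IH]|(k & Hk & E & Hn & IH)]]; cbn [nat_rect].
    - left. split; [reflexivity|lia].
    - rewrite E. cbn [ifz]. destruct (Nat.eq_dec (Q t) 0) as [E0|E0].
      + left. split; [exact E0|]. intros k' Hk'.
        destruct (Nat.eq_dec k' t) as [->|]; [exact E0|apply IH; lia].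
      + right. exists t. auto.
    - right. exists k. rewrite E. repeat split; auto.
      destruct (Q k); [contradiction|reflexivity]. }
  destruct G as [[E _]|(k & Hk & E & _ & Hl)]; [contradiction|eauto].
Qed.

Lemma first_nz_complete Q t k : k < t -> Q k <> 0 -> first_nz Q t <> 0.
Proof.
  unfold first_nz. intros Hk HQ. induction t as [|t IH]; cbn [nat_rect]; [lia|].
  destruct (Nat.eq_dec k t) as [->|].
  - destruct (nat_rect _ _ _ t) eqn:E; cbn [ifz]; [exact HQ|discriminate].
  - destruct (nat_rect _ _ _ t) eqn:E; cbn [ifz]; [|discriminate].
    exfalso. apply IH; lia.
Qed.

(* The test [P] succeeds at [r] when [P r = 0]. *)
Definition greatest (P : nat -> nat) (n : nat) : nat :=
  nat_rect (fun _ => nat) 0 (fun _ r => ifz (P (S r)) (S r) r) n.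

Lemma tr_greatest P n :
  tr2 P -> total_recursive n -> total_recursive (fun x => greatest (P x) (n x)).
Proof.
  intros HP Hn. unfold greatest.
  apply (tr_nat_rect (fun _ => 0) (fun x _ r => ifz (P x (S r)) (S r) r) n); tr_tac.
Qed.

(** The recursion climbs from 0 and stops for good where the next value fails. [P] need not be
    monotone, so all that is claimed is a success followed by a failure, or the end of the range;
    this is enough for quotients and square roots. *)
Lemma greatest_spec P n :
  P 0 = 0 ->
  P (greatest P n) = 0 /\ (greatest P n = n \/ P (S (greatest P n)) <> 0).
Proof.
  unfold greatest. intro H0. induction n as [|n [IH1 IH2]]; cbn [nat_rect]; [auto|].
  set (r := nat_rect _ _ _ n) in *. destruct (P (S r)) eqn:E; cbn [ifz].
  - split; [exact E|]. left. destruct IH2; [lia|contradiction].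
  - split; [exact IH1|]. right. lia.
Qed.

Definition quot (a b : nat) : nat := greatest (fun r => r * b - a) a.

Lemma tr_quot f g :
  total_recursive f -> total_recursive g -> total_recursive (fun x => quot (f x) (g x)).
Proof.
  intros Hf Hg. unfold quot.
  apply (tr_greatest (fun x r => r * g x - f x) f); tr_tac.
Qed.

Lemma quot_spec a b : 0 < b -> quot a b * b <= a /\ a < S (quot a b) * b.
Proof.
  intro Hb. unfold quot. set (P := fun r => r * b - a).
  destruct (greatest_spec P a eq_refl) as [H1 H2]. unfold P in H1, H2 at 2.
  fold P in H1. split; [lia|]. destruct H2 as [H2|H2]; [rewrite H2; nia|lia].
Qed.

(** * Operations on codes of lists *)

Definition chd (c : nat) : nat := p1 (Nat.pred c).
Definition ctl (c : nat) : nat := p2 (Nat.pred c).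
Definition cdrop (i c : nat) : nat := nat_rect (fun _ => nat) c (fun _ r => ctl r) i.
Definition cnth (i c : nat) : nat := chd (cdrop i c).
(** Counts the positions below [c] at which something is left of the list; a code is at least the
    length of its list, so [c] is a sufficient range. *)
Definition clen (c : nat) : nat :=
  nat_rect (fun _ => nat) 0 (fun i r => ifz (cdrop i c) r (S r)) c.

Lemma tr_cdrop f g :
  total_recursive f -> total_recursive g -> total_recursive (fun x => cdrop (f x) (g x)).
Proof.
  intros Hf Hg. unfold cdrop, ctl.
  apply (tr_nat_rect g (fun _ _ r => p2 (Nat.pred r)) f); tr_tac.
Qed.

Lemma tr_cnth f g :
  total_recursive f -> total_recursive g -> total_recursive (fun x => cnth (f x) (g x)).
Proof.
  intros Hf Hg. unfold cnth, chd. apply tr_p1, tr_pred. now apply tr_cdrop.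
Qed.

Lemma tr_clen f : total_recursive f -> total_recursive (fun x => clen (f x)).
Proof.
  intro Hf. unfold clen.
  apply (tr_nat_rect (fun _ => 0) (fun x i r => ifz (cdrop i (f x)) r (S r)) f);
    tr_tac. apply tr_cdrop; tr_tac.
Qed.

Lemma cdrop_code_list i l : cdrop i (code_list l) = code_list (skipn i l).
Proof.
  revert l. assert (E : forall c, cdrop (S i) c = cdrop i (ctl c)).
  { intro c. unfold cdrop. induction i as [|i IH]; [reflexivity|].
    cbn [nat_rect] in *. now rewrite IH. }
  clear E. induction i as [|i IH]; intro l; [reflexivity|].
  change (cdrop (S i) (code_list l)) with (ctl (cdrop i (code_list l))).
  rewrite IH. replace (skipn (S i) l) with (tl (skipn i l)).
  - destruct (skipn i l) as [|a m]; [reflexivity|].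
    unfold ctl. cbn [code_list Nat.pred tl]. apply p2_to_nat.
  - clear IH. revert l. induction i as [|i IHi]; intros [|a l]; try reflexivity.
    cbn [skipn] in *. rewrite IHi. reflexivity.
Qed.

Lemma cnth_code_list i l : cnth i (code_list l) = nth i l 0.
Proof.
  unfold cnth. rewrite cdrop_code_list. revert l.
  induction i as [|i IH]; intros [|a l]; try reflexivity.
  - cbn [skipn code_list nth]. unfold chd. cbn [Nat.pred]. apply p1_to_nat.
  - cbn [skipn nth]. apply IH.
Qed.

Lemma to_nat_ge1 x y : x <= to_nat (x, y).
Proof. pose proof (to_nat_non_decreasing x y). lia. Qed.

Lemma to_nat_ge2 x y : y <= to_nat (x, y).
Proof. pose proof (to_nat_non_decreasing x y). lia. Qed.

Lemma to_nat_lt2 x y y' : y < y' -> to_nat (x, y) < to_nat (x, y').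
Proof.
  intro H. rewrite !to_nat_triangle.
  pose proof (triangle_le (y + x) (y' + x)). lia.
Qed.

Lemma length_le_code_list l : length l <= code_list l.
Proof.
  induction l as [|a l IH]; cbn [length code_list]; [lia|].
  pose proof (to_nat_ge2 a (code_list l)). lia.
Qed.

Lemma nth_le_code_list i l : nth i l 0 <= code_list l.
Proof.
  revert i. induction l as [|a l IH]; intros [|i]; cbn [nth code_list]; try lia.
  - pose proof (to_nat_ge1 a (code_list l)). lia.
  - pose proof (to_nat_ge2 a (code_list l)). specialize (IH i). lia.
Qed.

Lemma clen_code_list l : clen (code_list l) = length l.
Proof.
  unfold clen. assert (G : forall m,
    nat_rect (fun _ => nat) 0 (fun i r => ifz (cdrop i (code_list l)) r (S r)) m
    = Nat.min m (length l)).
  { induction m as [|m IH]; cbn [nat_rect]; [reflexivity|].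
    rewrite IH, cdrop_code_list. destruct (skipn m l) as [|b l'] eqn:E.
    - cbn [code_list ifz]. apply (f_equal (@length nat)) in E.
      rewrite length_skipn in E. simpl in E. lia.
    - cbn [code_list ifz]. apply (f_equal (@length nat)) in E.
      rewrite length_skipn in E. simpl in E. lia. }
  rewrite G. pose proof (length_le_code_list l). lia.
Qed.

(** A code grows at its head, so the list is built from its last entry backwards and step [t]
    contributes entry [L - S t]. *)
Definition cmk (g : nat -> nat) (L : nat) : nat :=
  nat_rect (fun _ => nat) 0 (fun t r => S (to_nat (g (L - S t), r))) L.

Lemma tr_cmk g L :
  tr2 g -> total_recursive L -> total_recursive (fun x => cmk (g x) (L x)).
Proof.
  intros Hg HL. unfold cmk.
  apply (tr_nat_rect (fun _ => 0) (fun x t r => S (to_nat (g x (L x - S t), r))) L);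
    tr_tac.
Qed.

Lemma cmk_spec g L : cmk g L = code_list (map g (seq 0 L)).
Proof.
  unfold cmk.
  assert (G : forall t, t <= L ->
    nat_rect (fun _ => nat) 0 (fun t r => S (to_nat (g (L - S t), r))) t
    = code_list (map g (seq (L - t) t))).
  { induction t as [|t IH]; intro Ht; cbn [nat_rect]; [reflexivity|].
    rewrite IH by lia. replace (L - t) with (S (L - S t)) by lia. reflexivity. }
  rewrite G by lia. now rewrite Nat.sub_diag.
Qed.

Lemma cmk_prefix q L : cmk q L = code_list (prefix q L).
Proof. apply cmk_spec. Qed.

Ltac tr_lemma ::=
  first [ apply tr_cnth | apply tr_clen | apply tr_quot | apply tr_cmk
        | apply tr_first_nz | apply tr_greatest
        | apply tr_ifz | apply tr_mul | apply tr_pow | apply tr_pred ].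

Lemma decode_fuel_enough f f' n : n <= f -> n <= f' -> decode_fuel f n = decode_fuel f' n.
Proof.
  revert f' n. induction f as [|f IH]; intros f' n H H'.
  - replace n with 0 by lia. destruct f'; reflexivity.
  - destruct n as [|n], f' as [|f']; try reflexivity; try lia.
    cbn [decode_fuel]. destruct (of_nat n) as [a b] eqn:E. f_equal. apply IH.
    + pose proof (to_nat_ge2 a b) as G. rewrite <- E, cancel_to_of in G. lia.
    + pose proof (to_nat_ge2 a b) as G. rewrite <- E, cancel_to_of in G. lia.
Qed.

Lemma decode_code_list l : decode_list (code_list l) = l.
Proof.
  unfold decode_list. induction l as [|a l IH]; [reflexivity|].
  cbn [code_list decode_fuel]. rewrite cancel_of_to. f_equal.
  etransitivity; [|exact IH]. apply decode_fuel_enough; [apply to_nat_ge2|lia].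
Qed.

Lemma code_decode_list n : code_list (decode_list n) = n.
Proof.
  unfold decode_list. assert (G : forall f n, n <= f -> code_list (decode_fuel f n) = n).
  { induction f as [|f IH]; intros k Hk; destruct k as [|k]; try reflexivity; try lia.
    cbn [decode_fuel]. destruct (of_nat k) as [a b] eqn:E. cbn [code_list].
    pose proof (to_nat_ge2 a b) as G. rewrite <- E, cancel_to_of in G.
    rewrite IH by lia. rewrite <- E, cancel_to_of. reflexivity. }
  now apply G.
Qed.

Lemma code_list_app_lt l a : code_list l < code_list (l ++ [a]).
Proof.
  induction l as [|b l IH]; cbn [app code_list]; [lia|].
  pose proof (to_nat_lt2 b _ _ IH). lia.
Qed.

Lemma prefix_S q m : prefix q (S m) = prefix q m ++ [q m].
Proof. unfold prefix. rewrite seq_S, map_app. reflexivity. Qed.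

Lemma length_prefix q m : length (prefix q m) = m.
Proof. unfold prefix. now rewrite length_map, length_seq. Qed.

Lemma nth_prefix q m i : nth i (prefix q m) 0 = if i <? m then q i else 0.
Proof.
  unfold prefix. destruct (Nat.ltb_spec i m).
  - rewrite (nth_indep _ 0 (q 0)) by now rewrite length_map, length_seq.
    rewrite map_nth, seq_nth by assumption. reflexivity.
  - apply nth_overflow. now rewrite length_map, length_seq.
Qed.

Lemma code_nw_prefix_lt n q m m' :
  m < m' -> code_nw n (prefix q m) < code_nw n (prefix q m').
Proof.
  unfold code_nw. intro H. apply to_nat_lt2. induction H as [|m' _ IH].
  - rewrite prefix_S. apply code_list_app_lt.
  - rewrite prefix_S. pose proof (code_list_app_lt (prefix q m') (q m')). lia.
Qed.

Lemma code_nw_prefix_ge n q m : m <= code_nw n (prefix q m).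
Proof.
  unfold code_nw. pose proof (to_nat_ge2 n (code_list (prefix q m))).
  pose proof (length_le_code_list (prefix q m)). rewrite length_prefix in *. lia.
Qed.

(** * Evaluation of names of partial functionals *)

Lemma eta_functional a p q q' : eta a p q -> eta a p q' -> q = q'.
Proof.
  intros H H'. apply functional_extensionality. intro n.
  destruct (H n) as (m & N & L & ->). destruct (H' n) as (m' & N' & L' & ->).
  destruct (Nat.lt_trichotomy m m') as [l|[->|l]]; [|reflexivity|].
  - elim N. now apply L'.
  - elim N'. now apply L.
Qed.

Lemma eta_value a p r n :
  eta a p r -> exists m, a (code_nw n (prefix p m)) = S (r n).
Proof.
  intro H. destruct (H n) as (m & N & _ & ->). exists m. lia.
Qed.

Lemma fun_choice (A B : Type) (P : A -> B -> Prop) :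
  (forall x, exists y, P x y) -> exists f, forall x, P x (f x).
Proof.
  intro H. exists (fun x => proj1_sig (constructive_indefinite_description _ (H x))).
  intro x. apply proj2_sig.
Qed.

Lemma least_nat (P : nat -> Prop) :
  (forall n, {P n} + {~ P n}) -> (exists n, P n) ->
  exists m, P m /\ forall k, k < m -> ~ P k.
Proof.
  intros dec [n Hn]. revert Hn. induction n as [n IH] using lt_wf_ind. intro Hn.
  destruct (classic (exists k, k < n /\ P k)) as [(k & Hk & HP)|H].
  - now apply (IH k).
  - exists n. split; [exact Hn|]. intros k Hk HP. apply H. eauto.
Qed.

Lemma eta_defined a p :
  (forall n, exists m, a (code_nw n (prefix p m)) <> 0) -> exists r, eta a p r.
Proof.
  intro H.
  assert (G : forall n, exists m, a (code_nw n (prefix p m)) <> 0 /\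
                forall m', m' < m -> a (code_nw n (prefix p m')) = 0).
  { intro n. destruct (least_nat _ (fun m =>
        match Nat.eq_dec (a (code_nw n (prefix p m))) 0 with
        | left e => right (fun h => h e) | right h => left h end) (H n)) as (m & Hm & L).
    exists m. split; [exact Hm|]. intros m' Hm'. specialize (L m' Hm'). lia. }
  destruct (fun_choice _ _ _ G) as [f Hf].
  exists (fun n => Nat.pred (a (code_nw n (prefix p (f n))))). intro n. exists (f n).
  destruct (Hf n) as [N L].
  repeat split; assumption.
Qed.

(* Position [N] of the result only depends on the prefix of length [2N+2] of the
   argument; the prefix is this long because in [bpair p s] it covers
   [p 0, ..., p N] and [s 0, ..., s N]. *)
Definition prefix_op (Phi : nat -> nat -> nat) (p : Baire) : Baire :=
  fun N => Phi N (code_list (prefix p (2 * N + 2))).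

(** The name answers 0 until the prefix has length [2N+2] and a successor from then on, so the least
    nonzero answer occurs exactly at that length. *)
Lemma computable_prefix_op Phi :
  tr2 Phi -> computable (fun p r => r = prefix_op Phi p).
Proof.
  intro H.
  exists (fun x => ifz (2 * p1 x + 2 - clen (p2 x)) (S (Phi (p1 x) (p2 x))) 0). split.
  - tr_tac.
  - intros p r -> N. exists (2 * N + 2).
    assert (E : forall m, p1 (code_nw N (prefix p m)) = N) by (intro; apply p1_to_nat).
    assert (E' : forall m, p2 (code_nw N (prefix p m)) = code_list (prefix p m))
      by (intro; apply p2_to_nat).
    split; [|split].
    + rewrite E, E', clen_code_list, length_prefix, Nat.sub_diag. discriminate.
    + intros m Hm. rewrite E, E', clen_code_list, length_prefix.
      replace (2 * N + 2 - m) with (S (2 * N + 1 - m)) by lia. reflexivity.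
    + rewrite E, E', clen_code_list, length_prefix, Nat.sub_diag. reflexivity.
Qed.

(** A finite part of a name, filled up with the value 0 by which [eta] asks for more input. *)
Definition truncation (p Q : nat -> nat) (B : nat) : Prop :=
  (forall c, c < B -> Q c = p c) /\ (forall c, B <= c -> Q c = 0).

(* The successor of [eta p q l] if evaluating it needs only the first [t] prefixes
   of [q], else [0]. *)
Definition peval (Q q : nat -> nat) (l t : nat) : nat :=
  first_nz (fun m => Q (to_nat (l, cmk q m))) t.

(** A nonzero answer must lie below [B]. Codes of prefixes increase with the length, so the answers
    for all shorter prefixes lie below [B] as well and the zeros found there are zeros of [p]. The
    prefix found is therefore the least one, as [eta] requires. *)
Lemma peval_sound p Q B q r l t :
  truncation p Q B -> eta p q r -> peval Q q l t <> 0 -> peval Q q l t = S (r l).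
Proof.
  intros [HQ HQ0] Hr Hn. unfold peval in *.
  destruct (first_nz_sound _ _ Hn) as (k & _ & E & L).
  rewrite E in Hn. rewrite cmk_prefix in Hn.
  assert (Hk : to_nat (l, code_list (prefix q k)) < B).
  { destruct (Nat.lt_ge_cases (to_nat (l, code_list (prefix q k))) B) as [h|h]; auto.
    elim Hn. now apply HQ0. }
  rewrite E, cmk_prefix. rewrite HQ in Hn |- * by exact Hk.
  destruct (Hr l) as (m & N & L' & ->). unfold code_nw in *.
  destruct (Nat.lt_trichotomy m k) as [h|[->|h]]; [| |].
  - specialize (L m h). cbn beta in L. rewrite cmk_prefix, HQ in L; [contradiction|].
    pose proof (code_nw_prefix_lt l q m k h). unfold code_nw in *. lia.
  - lia.
  - elim Hn. now apply L'.
Qed.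

Lemma peval_complete p q r l :
  eta p q r -> exists t0, forall t B Q,
    truncation p Q B -> t0 <= t -> t0 <= B -> peval Q q l t = S (r l).
Proof.
  intro Hr. destruct (Hr l) as (m & N & L & E).
  exists (S (code_nw l (prefix q m))). intros t B Q HQ Ht HB.
  apply (peval_sound p Q B); [exact HQ|exact Hr|].
  apply first_nz_complete with m.
  - pose proof (code_nw_prefix_ge l q m). lia.
  - rewrite cmk_prefix. destruct HQ as [HQ _]. unfold code_nw in *. rewrite HQ by lia.
    exact N.
Qed.

Lemma tr_peval Q q l t :
  tr2 Q -> tr2 q -> total_recursive l -> total_recursive t ->
  total_recursive (fun x => peval (Q x) (q x) (l x) (t x)).
Proof.
  intros HQ Hq Hl Ht. unfold peval.
  apply (tr_first_nz (fun x m => Q x (to_nat (l x, cmk (q x) m))) t); [|exact Ht].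
  tr_tac.
Qed.

(** * The bounded inverse theorem *)

Local Open Scope R_scope.

(** * Vector space identities by reflection *)

Inductive vexp := VZ | VA (i : nat) | VP (a b : vexp) | VM (r : R) (a : vexp).

Fixpoint veval {V : NSpace} (env : nat -> V) (e : vexp) : V :=
  match e with
  | VZ => vzero
  | VA i => env i
  | VP a b => vadd (veval env a) (veval env b)
  | VM r a => vscal r (veval env a)
  end.

Fixpoint vcoef (e : vexp) (i : nat) : R :=
  match e with
  | VZ => 0
  | VA j => if Nat.eqb i j then 1 else 0
  | VP a b => vcoef a i + vcoef b i
  | VM r a => r * vcoef a i
  end.

Fixpoint vbound (N : nat) (e : vexp) : bool :=
  match e with
  | VZ => true
  | VA j => Nat.ltb j N
  | VP a b => vbound N a && vbound N b
  | VM _ a => vbound N a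
  end.

Lemma vadd_0_r (V : NSpace) (HV : is_banach V) (x : V) : vadd x vzero = x.
Proof.
  destruct HV as (_ & C & Z & _). now rewrite C, Z.
Qed.

Lemma vscal_0_l (V : NSpace) (HV : is_banach V) (x : V) : vscal 0 x = vzero.
Proof.
  destruct HV as (_ & _ & _ & I & U & _ & D & _).
  replace 0 with (1 + -1) by ring. now rewrite D, U, I.
Qed.

Lemma vscal_0_r (V : NSpace) (HV : is_banach V) (a : R) : vscal a vzero = vzero :> V.
Proof.
  rewrite <- (vscal_0_l V HV vzero). destruct HV as (_ & _ & _ & _ & _ & M & _).
  rewrite M. f_equal. ring.
Qed.

Lemma lincomb_map_add (V : NSpace) (HV : is_banach V) (e : nat -> V)
    (f g : nat -> R) (s : list nat) k :
  lincomb e k (map (fun i => f i + g i) s)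
  = vadd (lincomb e k (map f s)) (lincomb e k (map g s)).
Proof.
  revert k. induction s as [|a s IH]; intro k; cbn [map lincomb].
  - now rewrite vadd_0_r.
  - destruct HV as (A & C & _ & _ & _ & _ & D & _). rewrite IH, D, !A. f_equal.
    rewrite <- !A. f_equal. apply C.
Qed.

Lemma lincomb_map_scal (V : NSpace) (HV : is_banach V) (e : nat -> V) c
    (f : nat -> R) (s : list nat) k :
  lincomb e k (map (fun i => c * f i) s) = vscal c (lincomb e k (map f s)).
Proof.
  revert k. induction s as [|a s IH]; intro k; cbn [map lincomb].
  - now rewrite vscal_0_r.
  - destruct HV as (_ & _ & _ & _ & _ & M & _ & D & _). now rewrite IH, D, M.
Qed.

Lemma lincomb_zeros (V : NSpace) (HV : is_banach V) (e : nat -> V) (s : list nat) k :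
  lincomb e k (map (fun _ => 0) s) = vzero.
Proof.
  revert k. induction s as [|a s IH]; intro k; cbn [map lincomb]; [reflexivity|].
  now rewrite IH, vscal_0_l, vadd_0_r.
Qed.

Lemma lincomb_unit (V : NSpace) (HV : is_banach V) (e : nat -> V) k N j :
  (k <= j < k + N)%nat ->
  lincomb e k (map (fun i => if Nat.eqb i j then 1 else 0) (seq k N)) = e j.
Proof.
  revert k. induction N as [|N IH]; intros k H; [lia|]. cbn [seq map lincomb].
  destruct (Nat.eqb_spec k j) as [->|n].
  - replace (map _ (seq (S j) N)) with (map (fun _ => 0) (seq (S j) N)).
    + rewrite lincomb_zeros, vadd_0_r by exact HV.
      now destruct HV as (_ & _ & _ & _ & U & _).
    + apply map_ext_in. intros i Hi. apply in_seq in Hi.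
      destruct (Nat.eqb_spec i j); [lia|reflexivity].
  - rewrite IH by lia. rewrite vscal_0_l by exact HV.
    now destruct HV as (_ & _ & Z & _).
Qed.

Lemma veval_lincomb (V : NSpace) (HV : is_banach V) (env : nat -> V) N e :
  vbound N e = true -> veval env e = lincomb env 0 (map (vcoef e) (seq 0 N)).
Proof.
  induction e as [|j|a IHa b IHb|r a IHa]; cbn [vbound veval vcoef]; intro H.
  - symmetry. now apply lincomb_zeros.
  - apply Nat.ltb_lt in H. symmetry. apply lincomb_unit; [exact HV|lia].
  - apply andb_prop in H as [Ha Hb]. now rewrite lincomb_map_add, IHa, IHb.
  - now rewrite lincomb_map_scal, IHa.
Qed.

Lemma veval_eq (V : NSpace) (HV : is_banach V) (env : nat -> V) N e1 e2 :
  vbound N e1 = true -> vbound N e2 = true ->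
  map (vcoef e1) (seq 0 N) = map (vcoef e2) (seq 0 N) -> veval env e1 = veval env e2.
Proof.
  intros H1 H2 H. now rewrite (veval_lincomb V HV env N e1), (veval_lincomb V HV env N e2), H.
Qed.

Ltac v_mem x l :=
  match l with
  | [] => constr:(false)
  | x :: _ => constr:(true)
  | _ :: ?l' => v_mem x l'
  end.

Ltac v_atoms l t :=
  lazymatch t with
  | vzero => l
  | vadd ?a ?b => let l1 := v_atoms l a in v_atoms l1 b
  | vscal _ ?a => v_atoms l a
  | ?x => let b := v_mem x l in
          lazymatch b with true => l | false => constr:(x :: l) end
  end.

Ltac v_pos x l :=
  lazymatch l with
  | x :: _ => constr:(O)
  | _ :: ?l' => let n := v_pos x l' in constr:(S n)
  end.

Ltac v_reify l t :=
  lazymatch t with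
  | vzero => constr:(VZ)
  | vadd ?a ?b => let a' := v_reify l a in let b' := v_reify l b in constr:(VP a' b')
  | vscal ?r ?a => let a' := v_reify l a in constr:(VM r a')
  | ?x => let n := v_pos x l in constr:(VA n)
  end.

(* Decides an identity of linear combinations by comparing coefficients; [tac] proves
   the coefficient identities. *)
Ltac vspace_with HV tac :=
  unfold vdist;
  lazymatch type of HV with is_banach ?V =>
  lazymatch goal with |- ?a = ?b =>
    let l0 := constr:(@nil (vcar V)) in
    let l1 := v_atoms l0 a in let l := v_atoms l1 b in
    let ea := v_reify l a in let eb := v_reify l b in
    let N := eval compute in (length l) in
    change (veval (fun i => nth i l vzero) ea = veval (fun i => nth i l vzero) eb);
    apply (veval_eq V HV _ N); [reflexivity|reflexivity|];
    cbn [map seq vcoef Nat.eqb];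
    repeat (apply f_equal2; [tac|]); reflexivity
  end end.
Ltac vspace HV := vspace_with HV ltac:(ring).

(** * Norm and distance *)

Lemma vnorm_scal (V : NSpace) (HV : is_banach V) a (x : V) :
  vnorm (vscal a x) = Rabs a * vnorm x.
Proof. apply HV. Qed.

Lemma vnorm_triangle (V : NSpace) (HV : is_banach V) (x y : V) :
  vnorm (vadd x y) <= vnorm x + vnorm y.
Proof. apply HV. Qed.

Lemma vnorm_zero (V : NSpace) (HV : is_banach V) : vnorm (@vzero V) = 0.
Proof.
  rewrite <- (vscal_0_l V HV vzero), vnorm_scal, Rabs_R0 by exact HV. ring.
Qed.

Lemma vnorm_opp (V : NSpace) (HV : is_banach V) (x : V) : vnorm (vscal (-1) x) = vnorm x.
Proof.
  rewrite vnorm_scal, Rabs_left by (exact HV || lra). lra.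
Qed.

Lemma vnorm_nonneg (V : NSpace) (HV : is_banach V) (x : V) : 0 <= vnorm x.
Proof.
  pose proof (vnorm_triangle V HV x (vscal (-1) x)) as H.
  rewrite vnorm_opp in H by exact HV.
  replace (vadd x (vscal (-1) x)) with (@vzero V) in H by vspace HV.
  rewrite vnorm_zero in H by exact HV. lra.
Qed.

Lemma vdist_refl (V : NSpace) (HV : is_banach V) (x : V) : vdist x x = 0.
Proof.
  replace (vdist x x) with (vnorm (@vzero V)); [now apply vnorm_zero|].
  unfold vdist. f_equal. vspace HV.
Qed.

Lemma vdist_sym (V : NSpace) (HV : is_banach V) (x y : V) : vdist x y = vdist y x.
Proof.
  unfold vdist. rewrite <- vnorm_opp by exact HV. f_equal. vspace HV.
Qed.

Lemma vdist_triangle (V : NSpace) (HV : is_banach V) (x y z : V) :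
  vdist x z <= vdist x y + vdist y z.
Proof.
  unfold vdist. eapply Rle_trans; [|now apply vnorm_triangle].
  apply Req_le. f_equal. vspace HV.
Qed.

Lemma vdist_nonneg (V : NSpace) (HV : is_banach V) (x y : V) : 0 <= vdist x y.
Proof. now apply vnorm_nonneg. Qed.

Lemma vdist_0_r (V : NSpace) (HV : is_banach V) (x : V) : vdist x vzero = vnorm x.
Proof. unfold vdist. f_equal. vspace HV. Qed.

Lemma vdist_eq (V : NSpace) (HV : is_banach V) (x y : V) : vdist x y = 0 -> x = y.
Proof.
  unfold vdist. intro H. apply HV in H.
  transitivity (vadd (vadd x (vscal (-1) y)) y); [vspace HV|]. rewrite H. vspace HV.
Qed.

Lemma vdist_le_limit (V : NSpace) (HV : is_banach V) (u : nat -> V) (x z : V) b :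
  (forall eps, eps > 0 -> exists N, forall n, (n >= N)%nat -> vdist (u n) x < eps) ->
  (exists N, forall n, (n >= N)%nat -> vdist (u n) z <= b) ->
  vdist x z <= b.
Proof.
  intros Hx [N HN]. apply le_epsilon. intros eps He.
  destruct (Hx eps He) as [N' HN']. set (n := Nat.max N N').
  pose proof (vdist_triangle V HV x (u n) z).
  pose proof (HN n ltac:(unfold n; lia)). pose proof (HN' n ltac:(unfold n; lia)).
  rewrite (vdist_sym V HV x (u n)) in *. lra.
Qed.

Lemma pow_half_pos n : 0 < (/ 2) ^ n.
Proof. apply pow_lt. lra. Qed.

Lemma pow_half_small eps : eps > 0 -> exists n, forall m, (n <= m)%nat -> (/ 2) ^ m < eps.
Proof.
  intro He. destruct (pow_lt_1_zero (/ 2) ltac:(rewrite Rabs_right; lra) eps He) as [n H].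
  exists n. intros m Hm. specialize (H m Hm). rewrite Rabs_right in H; [exact H|].
  apply Rle_ge, Rlt_le, pow_half_pos.
Qed.

(** * Baire category and bounded preimages *)

Definition linear_map {V W : NSpace} (T : V -> W) : Prop :=
  (forall x y, T (vadd x y) = vadd (T x) (T y)) /\
  (forall a x, T (vscal a x) = vscal a (T x)).

(** [y] lies in the closure of the image of the closed ball of radius [c]. *)
Definition approx_image {V W : NSpace} (T : V -> W) (c : R) (y : W) : Prop :=
  forall eps, eps > 0 -> exists x, vnorm x <= c /\ vdist (T x) y < eps.

(* Baire's theorem for the closures of the images of the balls of radius n, by nested
   balls. *)
Lemma image_closure_has_interior (V W : NSpace) (HW : is_banach W) (T : V -> W) :
  (forall y, exists x, T x = y) ->
  exists (n : nat) (y0 : W) (r : R), r > 0 /\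
    forall y, vdist y y0 < r -> approx_image T (INR n) y.
Proof.
  intro Hsurj. apply NNPP. intro Hno.
  (* Every ball contains one of at most half its radius that misses the image of the ball of radius
     [n], as otherwise [Hno] fails for the given ball. The guard on the radius makes the step a
     total function, as choice requires. *)
  assert (Hstep : forall (n : nat) (yr : W * R), exists yr' : W * R, snd yr > 0 ->
    snd yr' > 0 /\ snd yr' <= snd yr / 2 /\
    (forall z, vdist z (fst yr') <= snd yr' -> vdist z (fst yr) <= snd yr) /\
    (forall x, vnorm x <= INR n -> vdist (T x) (fst yr') > snd yr')).
  { intros n [y r]. cbn [fst snd].
    destruct (Rlt_dec 0 r) as [Hr|Hr]; [|exists (y, r); intro; lra].
    apply NNPP. intro Hn. apply Hno. exists n, y, r. split; [exact Hr|].
    intros y' Hy' eps He. apply NNPP. intro Hx. apply Hn.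
    set (r' := Rmin eps (r - vdist y' y) / 2).
    assert (Hr' : 0 < r' /\ r' < eps /\ r' < r - vdist y' y /\ r' <= r / 2).
    { pose proof (vdist_nonneg W HW y' y).
      unfold r', Rmin. destruct (Rle_dec eps (r - vdist y' y)); lra. }
    exists (y', r'). cbn [fst snd]. intros _. repeat split; try lra.
    - intros z Hz. pose proof (vdist_triangle W HW z y' y). lra.
    - intros x Hxn. apply Rnot_le_gt. intro Hle. apply Hx. exists x. split; [exact Hxn|lra]. }
  destruct (fun_choice _ _ _ (fun n => fun_choice _ _ _ (Hstep n))) as [step step_spec].
  cbn beta in step_spec.
  pose (s := nat_rect (fun _ => (W * R)%type) (vzero, 1) (fun n yr => step n yr)).
  assert (Hpos : forall n, snd (s n) > 0).
  { induction n as [|n IH]; [cbn; lra|]. apply (step_spec n (s n) IH). }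
  assert (Hsmall : forall n, snd (s n) <= (/ 2) ^ n).
  { induction n as [|n IH]; [cbn; lra|].
    destruct (step_spec n (s n) (Hpos n)) as (_ & H & _).
    change (snd (s (S n)) <= snd (s n) / 2) in H. simpl pow. lra. }
  assert (Hnest : forall n m, (n <= m)%nat -> forall z,
            vdist z (fst (s m)) <= snd (s m) -> vdist z (fst (s n)) <= snd (s n)).
  { induction 1 as [|m _ IH]; [auto|]. intros z Hz. apply IH.
    now apply (step_spec m (s m) (Hpos m)). }
  assert (Hin : forall n m, (n <= m)%nat -> vdist (fst (s m)) (fst (s n)) <= snd (s n)).
  { intros n m H. apply (Hnest n m H). rewrite vdist_refl by exact HW.
    specialize (Hpos m). lra. }
  assert (Hlim : exists y, forall eps, eps > 0 -> exists N, forall n, (n >= N)%nat ->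
            vdist (fst (s n)) y < eps).
  { apply HW. intros eps He. destruct (pow_half_small (eps / 2)) as [N HN]; [lra|].
    exists N. intros m n Hm Hn.
    pose proof (vdist_triangle W HW (fst (s m)) (fst (s N)) (fst (s n))) as Htr.
    rewrite (vdist_sym W HW (fst (s N))) in Htr.
    pose proof (Hin N m Hm). pose proof (Hin N n Hn).
    specialize (HN N (le_n N)). specialize (Hsmall N). lra. }
  (* The limit lies in all the balls, but its preimage [x] has norm below some [n], and step [n] has
     excluded the image of every such [x]. *)
  destruct Hlim as [y Hy]. destruct (Hsurj y) as [x Hx].
  destruct (INR_unbounded (vnorm x)) as [n Hn].
  destruct (step_spec n (s n) (Hpos n)) as (_ & _ & _ & H).
  specialize (H x ltac:(lra)). apply (Rgt_not_le _ _ H).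
  change (vdist (T x) (fst (s (S n))) <= snd (s (S n))). rewrite Hx.
  apply (vdist_le_limit W HW (fun m => fst (s m)) y); [exact Hy|].
  exists (S n). intros m Hm. now apply Hin.
Qed.

Lemma linear_map_zero (V W : NSpace) (HV : is_banach V) (HW : is_banach W) (T : V -> W) :
  linear_map T -> T vzero = vzero.
Proof.
  intros [_ H]. rewrite <- (vscal_0_l V HV vzero), H. now apply vscal_0_l.
Qed.

(** With [t = r / (2 |y|)], both [y0 + t y] and [y0] lie in the ball of
    [image_closure_has_interior]. The difference of their approximate preimages, divided by [t], is
    an approximate preimage of [y] of norm at most [2 n / t = (4 n / r) |y|]. *)
Lemma approx_image_ball (V W : NSpace) (HV : is_banach V) (HW : is_banach W) (T : V -> W) :
  linear_map T -> (forall y, exists x, T x = y) ->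
  exists C, C >= 0 /\ forall y, approx_image T (C * vnorm y) y.
Proof.
  intros [Tadd Tscal] Hsurj.
  destruct (image_closure_has_interior V W HW T Hsurj) as (n & y0 & r & Hr & Hball).
  pose proof (pos_INR n) as Hn.
  exists (4 * INR n / r). split.
  { apply Rle_ge, Rmult_le_pos; [lra|]. left. now apply Rinv_0_lt_compat. }
  intros y eps He.
  destruct (Req_dec (vnorm y) 0) as [E|E].
  - exists vzero. assert (y = vzero) as -> by now apply HW.
    rewrite linear_map_zero, vdist_refl, !vnorm_zero by (assumption || split; assumption).
    lra.
  - assert (Hy : 0 < vnorm y) by (pose proof (vnorm_nonneg W HW y); lra).
    set (t := r / (2 * vnorm y)).
    assert (Ht : 0 < t) by (apply Rdiv_lt_0_compat; lra).
    assert (Hd1 : vdist (vadd y0 (vscal t y)) y0 < r).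
    { replace (vdist _ _) with (vnorm (vscal t y)) by (unfold vdist; f_equal; vspace HW).
      rewrite vnorm_scal, Rabs_right by (exact HW || lra).
      replace (t * vnorm y) with (r / 2) by (unfold t; field; lra). lra. }
    assert (Hd2 : vdist y0 y0 < r) by (rewrite vdist_refl by exact HW; exact Hr).
    assert (Hte : t * eps / 2 > 0) by nra.
    destruct (Hball _ Hd1 _ Hte) as (x1 & Hx1 & H1).
    destruct (Hball _ Hd2 _ Hte) as (x2 & Hx2 & H2).
    exists (vscal (/ t) (vadd x1 (vscal (-1) x2))).
    assert (Hti : 0 < / t) by now apply Rinv_0_lt_compat. split.
    + rewrite vnorm_scal, Rabs_right by (exact HV || lra).
      pose proof (vnorm_triangle V HV x1 (vscal (-1) x2)) as Htr.
      rewrite vnorm_opp in Htr by exact HV.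
      replace (4 * INR n / r * vnorm y) with (/ t * (2 * INR n))
        by (unfold t; field; lra).
      apply Rmult_le_compat_l; lra.
    + rewrite Tscal, Tadd, Tscal.
      replace (vdist _ y) with
        (vnorm (vscal (/ t) (vadd (vadd (T x1) (vscal (-1) (vadd y0 (vscal t y))))
                              (vscal (-1) (vadd (T x2) (vscal (-1) y0)))))).
      * rewrite vnorm_scal, Rabs_right by (exact HW || lra).
        pose proof (vnorm_triangle W HW (vadd (T x1) (vscal (-1) (vadd y0 (vscal t y))))
                              (vscal (-1) (vadd (T x2) (vscal (-1) y0)))) as Htr.
        rewrite vnorm_opp in Htr by exact HW. unfold vdist in H1, H2.
        apply Rlt_le_trans with (/ t * (t * eps)).
        -- apply Rmult_lt_compat_l; lra.
        -- apply Req_le. field. lra.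
      * unfold vdist. f_equal. vspace_with HW ltac:(field; lra).
Qed.

(** Successive approximation: the residual [y - T u_k] is corrected by an approximate preimage,
    which at least halves the bound on it. The corrections are dominated by [C |y| 2^-k], so they
    converge by completeness of [V], and the geometric series yields the factor 2. *)
Lemma bounded_preimage (V W : NSpace) (HV : is_banach V) (HW : is_banach W) (T : V -> W) :
  linear_map T -> (exists c, forall x, vnorm (T x) <= c * vnorm x) ->
  (forall y, exists x, T x = y) ->
  exists C, forall y, exists x, T x = y /\ vnorm x <= C * vnorm y.
Proof.
  intros HT [c Hc] Hsurj.
  destruct (approx_image_ball V W HV HW T HT Hsurj) as (C & HC & Happ).
  exists (2 * C). intro y.
  destruct (Req_dec (vnorm y) 0) as [E|E].
  { assert (y = vzero) as -> by now apply HW. exists vzero.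
    rewrite linear_map_zero, !vnorm_zero by assumption. split; [reflexivity|lra]. }
  assert (Hy : 0 < vnorm y) by (pose proof (vnorm_nonneg W HW y); lra).
  (* The tolerance refers to the fixed [y] and not to the current residual [z], so it stays positive
     even if a residual vanishes. *)
  assert (Hg : forall (k : nat) (z : W), exists x,
             vnorm x <= C * vnorm z /\ vdist (T x) z < vnorm y * (/ 2) ^ S k).
  { intros k z. apply Happ. pose proof (pow_half_pos (S k)). nra. }
  destruct (fun_choice _ _ _ (fun k => fun_choice _ _ _ (Hg k))) as [g g_spec].
  cbn beta in g_spec.
  pose (u := nat_rect (fun _ => vcar V) vzero
               (fun k v => vadd v (g k (vadd y (vscal (-1) (T v)))))).
  pose (z := fun k => vadd y (vscal (-1) (T (u k)))).
  assert (Tadd := proj1 HT).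
  assert (Hz : forall k, vnorm (z k) <= vnorm y * (/ 2) ^ k).
  { intros [|k].
    - unfold z. cbn [u nat_rect pow]. rewrite linear_map_zero by assumption.
      apply Req_le. rewrite Rmult_1_r. f_equal. vspace HW.
    - unfold z at 1. change (u (S k)) with (vadd (u k) (g k (z k))). rewrite Tadd.
      destruct (g_spec k (z k)) as [_ H]. rewrite vdist_sym in H by exact HW.
      left. eapply Rle_lt_trans; [|exact H]. apply Req_le. unfold vdist. f_equal.
      generalize (g k (z k)). intro x'. unfold z. vspace HW. }
  assert (Hx : forall k, vnorm (g k (z k)) <= C * vnorm y * (/ 2) ^ k).
  { intro k. eapply Rle_trans; [apply (g_spec k (z k))|].
    rewrite Rmult_assoc. apply Rmult_le_compat_l; [lra|apply Hz]. }
  (* The subtracted term, the part of the geometric series beyond [m], is what makes the bound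
     inductive. *)
  assert (Hu : forall n m, (n <= m)%nat ->
     vdist (u m) (u n) <= C * vnorm y * (2 * (/ 2) ^ n - 2 * (/ 2) ^ m)).
  { induction 1 as [|m _ IH].
    - rewrite vdist_refl by exact HV. lra.
    - change (u (S m)) with (vadd (u m) (g m (z m))).
      pose proof (vnorm_triangle V HV (vadd (u m) (vscal (-1) (u n))) (g m (z m))) as Htr.
      replace (vadd (vadd (u m) _) _) with
        (vadd (vadd (u m) (g m (z m))) (vscal (-1) (u n))) in Htr
        by (generalize (g m (z m)); intro x'; vspace HV).
      unfold vdist in *. specialize (Hx m). simpl pow.
      assert (/ 2 * 2 = 1) by lra. nra. }
  assert (Hu' : forall n m, (n <= m)%nat -> vdist (u m) (u n) <= 2 * C * vnorm y * (/ 2) ^ n).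
  { intros n m H. eapply Rle_trans; [now apply Hu|]. pose proof (pow_half_pos m).
    assert (0 <= C * vnorm y) by nra. nra. }
  assert (Hlim : exists x, forall eps, eps > 0 -> exists N, forall n, (n >= N)%nat ->
            vdist (u n) x < eps).
  { apply HV. intros eps He. set (D := 4 * C * vnorm y + 1).
    assert (HD : 1 <= D) by (unfold D; nra).
    destruct (pow_half_small (eps / D)) as [N HN]; [apply Rdiv_lt_0_compat; lra|].
    exists N. intros m n Hm Hn.
    pose proof (vdist_triangle V HV (u m) (u N) (u n)) as Htr.
    rewrite (vdist_sym V HV (u N)) in Htr.
    pose proof (Hu' N m Hm). pose proof (Hu' N n Hn).
    specialize (HN N (le_n N)). apply Rmult_lt_compat_r with (r := D) in HN; [|lra].
    replace (eps / D * D) with eps in HN by (field; lra).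
    pose proof (pow_half_pos N). unfold D in HN. lra. }
  destruct Hlim as [x Hlim]. exists x.
  assert (Hux : forall n, vdist x (u n) <= 2 * C * vnorm y * (/ 2) ^ n).
  { intro n. apply (vdist_le_limit V HV u x); [exact Hlim|]. exists n. intros m Hm.
    now apply Hu'. }
  split.
  - apply (vdist_eq W HW). apply Rle_antisym; [|now apply vdist_nonneg].
    apply le_epsilon. intros eps He. rewrite Rplus_0_l.
    (* [|T x - y| <= |c| |x - u_N| + |y - T u_N|], and [D 2^-N] bounds this sum. *)
    set (D := Rabs c * (2 * C * vnorm y) + vnorm y).
    assert (HD : 0 < D).
    { unfold D. pose proof (Rabs_pos c). assert (0 <= C * vnorm y) by nra. nra. }
    destruct (pow_half_small (eps / D)) as [N HN]; [apply Rdiv_lt_0_compat; lra|].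
    specialize (HN N (le_n N)). apply Rmult_lt_compat_r with (r := D) in HN; [|lra].
    replace (eps / D * D) with eps in HN by (field; lra).
    left. eapply Rle_lt_trans; [|exact HN].
    eapply Rle_trans; [apply (vdist_triangle W HW _ (T (u N)))|].
    replace (vdist (T (u N)) y) with (vnorm (z N))
      by (unfold z; rewrite vdist_sym by exact HW; reflexivity).
    replace (vdist (T x) (T (u N))) with (vnorm (T (vadd x (vscal (-1) (u N)))))
      by (rewrite Tadd, (proj2 HT); reflexivity).
    pose proof (Hz N). pose proof (Hc (vadd x (vscal (-1) (u N)))).
    specialize (Hux N). unfold vdist in Hux.
    set (d := vnorm (vadd x (vscal (-1) (u N)))) in *.
    assert (0 <= d) by now apply vnorm_nonneg.
    assert (c * d <= Rabs c * d) by (apply Rmult_le_compat_r; [lra|apply Rle_abs]).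
    assert (Rabs c * d <= Rabs c * (2 * C * vnorm y * (/ 2) ^ N))
      by (apply Rmult_le_compat_l; [apply Rabs_pos|exact Hux]).
    unfold D. lra.
  - specialize (Hux 0%nat). simpl in Hux. rewrite vdist_0_r in Hux by exact HV. lra.
Qed.

Lemma bounded_inverse (V W : NSpace) (HV : is_banach V) (HW : is_banach W) (T : V -> W) :
  linear_map T -> (exists c, forall x, vnorm (T x) <= c * vnorm x) ->
  (forall x y, T x = T y -> x = y) -> (forall y, exists x, T x = y) ->
  exists n : nat, forall x, vnorm x <= INR n * vnorm (T x).
Proof.
  intros HT Hc Hinj Hsurj.
  destruct (bounded_preimage V W HV HW T HT Hc Hsurj) as [C HC].
  destruct (INR_unbounded C) as [n Hn]. exists n. intro x.
  destruct (HC (T x)) as (x' & E & H). rewrite (Hinj _ _ E) in H.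
  pose proof (vnorm_nonneg W HW (T x)). nra.
Qed.

(** * Inversion reduces to choice on the natural numbers *)

Lemma Q2R_Qmake_nat z b : Q2R (Qmake z (Pos.of_succ_nat b)) = IZR z / INR (S b).
Proof.
  unfold Q2R. cbn [Qnum Qden]. rewrite INR_IZR_INZ. reflexivity.
Qed.

Lemma Q2R_nat_to_Q k :
  Q2R (nat_to_Q k)
  = (if Nat.even (p1 k) then INR (Nat.div2 (p1 k)) else - INR (Nat.div2 (S (p1 k))))
    / INR (S (p2 k)).
Proof.
  unfold nat_to_Q, p1, p2. destruct (of_nat k) as [a b]. cbn [fst snd].
  rewrite Q2R_Qmake_nat. destruct (Nat.even a).
  - now rewrite <- INR_IZR_INZ.
  - now rewrite opp_IZR, <- INR_IZR_INZ.
Qed.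

Lemma INR_S_pos n : 0 < INR (S n).
Proof. apply lt_0_INR. lia. Qed.

Lemma nat_to_Q_dense (r eps : R) :
  eps > 0 -> exists k, Rabs (r - Q2R (nat_to_Q k)) < eps.
Proof.
  intro He. destruct (INR_unbounded (/ eps)) as [b Hb].
  assert (Hb' : / INR (S b) < eps).
  { rewrite <- (Rinv_inv eps). apply Rinv_lt_contravar.
    - apply Rmult_lt_0_compat; [now apply Rinv_0_lt_compat|apply INR_S_pos].
    - rewrite S_INR. lra. }
  pose proof (INR_S_pos b) as Hp.
  assert (G : exists a, Q2R (nat_to_Q (to_nat (a, b))) = IZR (up (r * INR (S b))) / INR (S b)).
  (* Even codes stand for the non-negative numerators and odd codes for the negative ones. *)
  { set (z := up _). destruct (Z.le_gt_cases 0 z) as [Hz|Hz].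
    - exists (2 * Z.to_nat z)%nat. rewrite Q2R_nat_to_Q, p1_to_nat, p2_to_nat, Nat.even_even.
      rewrite Nat.div2_double, INR_IZR_INZ, Z2Nat.id by exact Hz. reflexivity.
    - exists (2 * (Z.to_nat (- z) - 1) + 1)%nat.
      rewrite Q2R_nat_to_Q, p1_to_nat, p2_to_nat, Nat.even_odd.
      replace (S _) with (2 * Z.to_nat (- z))%nat by lia.
      rewrite Nat.div2_double, INR_IZR_INZ, Z2Nat.id, opp_IZR by lia. f_equal. ring. }
  destruct G as [a Ha]. exists (to_nat (a, b)). rewrite Ha.
  destruct (archimed (r * INR (S b))) as [H1 H2].
  eapply Rle_lt_trans; [|exact Hb'].
  replace (r - _) with ((r * INR (S b) - IZR (up (r * INR (S b)))) * / INR (S b))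
    by (field; lra).
  rewrite Rabs_mult, (Rabs_right (/ _)) by (left; now apply Rinv_0_lt_compat).
  rewrite <- (Rmult_1_l (/ INR (S b))) at 2. apply Rmult_le_compat_r.
  - left. now apply Rinv_0_lt_compat.
  - apply Rabs_le. lra.
Qed.

Lemma lincomb_rational_approx (V : NSpace) (HV : is_banach V) (e : nat -> V) (l : list R) :
  forall k eps, eps > 0 -> exists ks,
    vdist (lincomb e k l) (lincomb e k (map (fun c => Q2R (nat_to_Q c)) ks)) < eps.
Proof.
  induction l as [|c l IH]; intros k eps He.
  - exists []. cbn [map]. rewrite vdist_refl by exact HV. exact He.
  - pose proof (vnorm_nonneg V HV (e k)) as Hn.
    (* The summand 1 covers the case that [e k] is zero. *)
    destruct (nat_to_Q_dense c (eps / 2 / (vnorm (e k) + 1))) as [q Hq].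
    { apply Rdiv_lt_0_compat; lra. }
    destruct (IH (S k) (eps / 2)) as [ks Hks]; [lra|].
    exists (q :: ks). cbn [map lincomb]. unfold vdist in *.
    set (x := lincomb e (S k) l) in *. set (y := lincomb e (S k) (map _ _)) in *.
    replace (vadd _ _) with
      (vadd (vscal (c - Q2R (nat_to_Q q)) (e k)) (vadd x (vscal (-1) y))) by vspace HV.
    eapply Rle_lt_trans; [now apply vnorm_triangle|].
    rewrite vnorm_scal by exact HV.
    assert (Rabs (c - Q2R (nat_to_Q q)) * vnorm (e k) <= eps / 2); [|lra].
    apply Rle_trans with (eps / 2 / (vnorm (e k) + 1) * (vnorm (e k) + 1)).
    + apply Rmult_le_compat; [apply Rabs_pos|exact Hn|lra|lra].
    + apply Req_le. field. lra.
Qed.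

Lemma cb_alpha_dense (X : CBSpace) (HX : is_CBS X) (x : cb_sp X) eps :
  eps > 0 -> exists i, vdist (cb_alpha X i) x < eps.
Proof.
  intro He. destruct HX as (HV & Hd & _).
  destruct (Hd x (eps / 2)) as [l Hl]; [lra|].
  destruct (lincomb_rational_approx _ HV (cb_e X) l 0 (eps / 2)) as [ks Hks]; [lra|].
  exists (code_list ks). unfold cb_alpha. rewrite decode_code_list.
  rewrite vdist_sym by exact HV.
  eapply Rle_lt_trans; [apply (vdist_triangle _ HV _ (lincomb (cb_e X) 0 l))|]. lra.
Qed.

Lemma cb_alpha_0 (X : CBSpace) : cb_alpha X 0 = vzero.
Proof. reflexivity. Qed.

Lemma cauchy_rep_dist (X : CBSpace) (HV : is_banach (cb_sp X)) p x n :
  cauchy_rep X p x -> vdist (cb_alpha X (p n)) x <= (/ 2) ^ n.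
Proof.
  intros [HC HL]. rewrite vdist_sym by exact HV.
  apply (vdist_le_limit _ HV (fun m => cb_alpha X (p m)) x); [exact HL|].
  exists n. intros m Hm. rewrite vdist_sym by exact HV. now apply HC.
Qed.

(** The errors [2^-(i+1)] and [2^-(j+1)] add up to at most [2^-i] for [i <= j], which is the rate
    that a name must have; this is why approximations are sought one bit more precisely. *)
Lemma cauchy_rep_intro (X : CBSpace) (HV : is_banach (cb_sp X)) p x :
  (forall n, vdist (cb_alpha X (p n)) x <= (/ 2) ^ S n) -> cauchy_rep X p x.
Proof.
  intro H. split.
  - intros i j Hij.
    pose proof (vdist_triangle _ HV (cb_alpha X (p i)) x (cb_alpha X (p j))) as Htr.
    rewrite (vdist_sym _ HV x) in Htr. pose proof (H i). pose proof (H j).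
    assert ((/ 2) ^ S j <= (/ 2) ^ S i).
    { rewrite !pow_inv. apply Rinv_le_contravar; [apply pow_lt; lra|].
      apply Rle_pow; [lra|lia]. }
    simpl pow in *. lra.
  - intros eps He. destruct (pow_half_small eps He) as [N HN]. exists N. intros n Hn.
    eapply Rle_lt_trans; [apply H|]. apply HN. lia.
Qed.

Lemma cauchy_rep_const (X : CBSpace) (HV : is_banach (cb_sp X)) i :
  cauchy_rep X (fun _ => i) (cb_alpha X i).
Proof.
  split; intros.
  - rewrite vdist_refl by exact HV. left. apply pow_half_pos.
  - exists 0%nat. intros. now rewrite vdist_refl.
Qed.

(** * Distances approximated by natural numbers *)

Lemma Rabs_le_bounds x a : Rabs x <= a -> - a <= x <= a.
Proof. unfold Rabs. destruct (Rcase_abs x); lra. Qed.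

(** Scaling by [2^l] turns every test on distances into a comparison of natural numbers. Of the
    error 2, one unit comes from the rational approximation and one from rounding. *)
Definition dist_approx (X : CBSpace) (d : nat -> nat -> nat -> nat) : Prop :=
  tr3 d /\ forall i j l,
    Rabs (2 ^ l * vdist (cb_alpha X i) (cb_alpha X j) - INR (d i j l)) <= 2.

Lemma pow_2_half n : 2 ^ n * (/ 2) ^ n = 1.
Proof. rewrite <- Rpow_mult_distr. replace (2 * / 2) with 1 by lra. apply pow1. Qed.

Lemma dist_approx_exists (X : CBSpace) (HX : is_CBS X) : exists d, dist_approx X d.
Proof.
  destruct HX as (HV & _ & b & Hb & Happ).
  (* [p1 q - 2 * quot (p1 q) 2] is the parity that encodes the sign; a negative approximation of a
     distance is replaced by 0. *)
  pose (d := fun i j l =>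
    (let q := b (to_nat (i, to_nat (j, l))) in
     ifz (p1 q - 2 * quot (p1 q) 2) (quot (quot (p1 q) 2 * 2 ^ l) (S (p2 q))) 0)%nat).
  exists d. split; [unfold d; tr_tac|].
  intros i j l. unfold d. set (q := b _). specialize (Happ i j l). fold q in Happ.
  rewrite Q2R_nat_to_Q in Happ.
  set (D := vdist _ _) in *. assert (HD : 0 <= D) by now apply vdist_nonneg.
  assert (HP : 0 < 2 ^ l) by (apply pow_lt; lra).
  pose proof (INR_S_pos (p2 q)) as Hden.
  destruct (quot_spec (p1 q) 2) as [Q1 Q2]; [lia|].
  pose proof (pow_2_half l) as HPl.
  apply Rabs_le_bounds in Happ.
  destruct (Nat.even (p1 q)) eqn:Ev.
  - apply Nat.even_spec in Ev as [m Em]. rewrite Em, Nat.div2_double in Happ.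
    rewrite Em in Q1, Q2 |- *. assert (quot (2 * m) 2 = m) as -> by lia.
    replace (2 * m - 2 * m)%nat with 0%nat by lia. cbn [ifz].
    destruct (quot_spec (m * 2 ^ l) (S (p2 q))) as [R1 R2]; [lia|].
    set (u := quot (m * 2 ^ l) (S (p2 q))) in *.
    apply le_INR in R1. apply lt_INR in R2. rewrite !mult_INR, pow_INR in R1, R2.
    rewrite (S_INR u) in R2. change (INR 2) with 2 in R1, R2.
    assert (E : INR m * 2 ^ l = INR m / INR (S (p2 q)) * 2 ^ l * INR (S (p2 q)))
      by (field; lra).
    rewrite E in R1, R2. apply Rmult_le_reg_r in R1; [|exact Hden].
    apply Rmult_lt_reg_r in R2; [|exact Hden].
    set (v := INR m / INR (S (p2 q))) in *. apply Rabs_le. nra.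
  - assert (Ho : Nat.odd (p1 q) = true) by (unfold Nat.odd; now rewrite Ev).
    apply Nat.odd_spec in Ho as [m Em].
    replace (p1 q - 2 * quot (p1 q) 2)%nat with 1%nat by lia. cbn [ifz INR].
    set (v := _ / _) in Happ. assert (v <= 0).
    { unfold v, Rdiv. assert (0 < / INR (S (p2 q))) by now apply Rinv_0_lt_compat.
      pose proof (pos_INR (Nat.div2 (S (p1 q)))). nra. }
    apply Rabs_le. nra.
Qed.

(** * Refuting bounds, and inverting with a bound *)

Lemma truncation_prefix p B : truncation p (fun c => cnth c (code_list (prefix p B))) B.
Proof.
  split; intros c Hc; rewrite cnth_code_list, nth_prefix;
    destruct (Nat.ltb_spec c B); (reflexivity || lia).
Qed.

Lemma bpair_even p s c : bpair p s (2 * c)%nat = p c.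
Proof. unfold bpair. now rewrite Nat.even_even, Nat.div2_double. Qed.

Lemma truncation_bpair p s N :
  truncation p (fun c => cnth (2 * c) (code_list (prefix (bpair p s) (2 * N + 2))))%nat (S N).
Proof.
  split; intros c Hc; rewrite cnth_code_list, nth_prefix;
    destruct (Nat.ltb_spec (2 * c) (2 * N + 2)%nat); try lia; try reflexivity.
  apply bpair_even.
Qed.

(* Enumerates the [n] that are not bounds for the inverse: [N = <n, <i, <l, _>>>] yields
   [S n] if the approximations of precision [2^-l] show [|alpha_i| > n |T alpha_i|]. *)
Definition non_bounds (dX dY : nat -> nat -> nat -> nat) (N cu : nat) : nat :=
  let n := p1 N in let i := p1 (p2 N) in let l := p1 (p2 (p2 N)) in
  let e := peval (fun c => cnth c cu) (fun _ => i) l N in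
  (ifz e 0 (ifz (S (2 + n * (dY (Nat.pred e) 0 l + 3)) - dX i 0 l) (S n) 0))%nat.

(* [T^-1 y] from a bound [n] for [T^-1]: if [|T alpha_i - y|] is small, then so is
   [|alpha_i - T^-1 y|]. Here [N = <k, w>] with [w] a prefix of the name of [y], and
   [z = <i, l>]. *)
Definition inverse_test (dY : nat -> nat -> nat -> nat) (N cu z : nat) : nat :=
  let k := p1 N in let w := p2 N in let n := cnth 1 cu in
  let i := p1 z in let l := p2 z in
  let e := peval (fun c => cnth (2 * c)%nat cu) (fun _ => i) l N in
  (ifz (S l - clen w)
     (ifz e 0
        (ifz ((dY (Nat.pred e) (cnth l w) l + 4) * (S n * 2 ^ S k) - 2 ^ l) (S i) 0))
     0)%nat.

Definition inverse_name (dY : nat -> nat -> nat -> nat) (N cu : nat) : nat :=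
  first_nz (inverse_test dY N cu) N.

Lemma tr_non_bounds dX dY : tr3 dX -> tr3 dY -> tr2 (non_bounds dX dY).
Proof.
  intros HX HY. unfold non_bounds.
  assert (E : total_recursive (fun z =>
    peval (fun c => cnth c (p2 z)) (fun _ => p1 (p2 (p1 z))) (p1 (p2 (p2 (p1 z)))) (p1 z))).
  { apply (tr_peval (fun z c => cnth c (p2 z)) (fun z _ => p1 (p2 (p1 z)))
             (fun z => p1 (p2 (p2 (p1 z)))) p1); tr_tac. }
  unfold tr2. set (e := fun z => peval _ _ _ _) in E.
  change (total_recursive (fun z => ifz (e z) 0
    (ifz (S (2 + p1 (p1 z) * (dY (Nat.pred (e z)) 0 (p1 (p2 (p2 (p1 z)))) + 3))
            - dX (p1 (p2 (p1 z))) 0 (p1 (p2 (p2 (p1 z))))) (S (p1 (p1 z))) 0)%nat)).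
  clearbody e. tr_tac.
Qed.

Lemma tr_inverse_name dY : tr3 dY -> tr2 (inverse_name dY).
Proof.
  intro HY. unfold inverse_name.
  apply (tr_first_nz (fun z => inverse_test dY (p1 z) (p2 z)) p1); [|tr_tac].
  unfold inverse_test.
  assert (E : total_recursive (fun z =>
    peval (fun c => cnth (2 * c)%nat (p2 (p1 z))) (fun _ => p1 (p2 z)) (p2 (p2 z)) (p1 (p1 z)))).
  { apply (tr_peval (fun z c => cnth (2 * c)%nat (p2 (p1 z))) (fun z _ => p1 (p2 z))
             (fun z => p2 (p2 z)) (fun z => p1 (p1 z))); tr_tac. }
  unfold tr2. set (e := fun z => peval _ _ _ _) in E.
  change (total_recursive (fun z => ifz (S (p2 (p2 z)) - clen (p2 (p1 (p1 z))))
    (ifz (e z) 0 (ifz ((dY (Nat.pred (e z)) (cnth (p2 (p2 z)) (p2 (p1 (p1 z)))) (p2 (p2 z)) + 4)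
        * (S (cnth 1 (p2 (p1 z))) * 2 ^ S (p1 (p1 (p1 z)))) - 2 ^ p2 (p2 z))
        (S (p1 (p2 z))) 0)) 0)%nat).
  clearbody e. tr_tac.
Qed.

Definition names {X Y : CBSpace} (p : Baire) (T : cb_sp X -> cb_sp Y) : Prop :=
  rep (RCFun X Y) p T.

Lemma names_const (X Y : CBSpace) (HX : is_CBS X) (HY : is_CBS Y) p
    (T : cb_sp X -> cb_sp Y) i :
  names p T -> exists r, eta p (fun _ => i) r /\
    forall l, vdist (cb_alpha Y (r l)) (T (cb_alpha X i)) <= (/ 2) ^ l.
Proof.
  intro Hp. destruct (Hp _ _ (cauchy_rep_const X (proj1 HX) i)) as (r & Hr & Hc).
  exists r. split; [exact Hr|]. intro l. now apply cauchy_rep_dist; [apply HY|].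
Qed.

Lemma vnorm_vdist_le (V : NSpace) (HV : is_banach V) (x y : V) :
  vnorm x <= vnorm y + vdist x y /\ vnorm y <= vnorm x + vdist x y.
Proof.
  pose proof (vdist_triangle V HV x y vzero) as H1.
  pose proof (vdist_triangle V HV y x vzero) as H2.
  rewrite !vdist_0_r in H1, H2 by exact HV. rewrite (vdist_sym V HV y x) in H2. lra.
Qed.

(** The constants of the test cover all errors at scale [2^l]: the true value for [alpha_i] is at
    least [dX - 2], and that for [T alpha_i] at most [dY + 3], where 2 belongs to [dist_approx] and
    1 to the name of [T alpha_i]. *)
Lemma non_bounds_sound (X Y : CBSpace) (HX : is_CBS X) (HY : is_CBS Y) dX dY p
    (T : cb_sp X -> cb_sp Y) N n :
  dist_approx X dX -> dist_approx Y dY -> names p T ->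
  prefix_op (non_bounds dX dY) p N = S n ->
  exists x, INR n * vnorm (T x) < vnorm x.
Proof.
  intros [_ AX] [_ AY] Hp. unfold prefix_op, non_bounds.
  set (i := p1 (p2 N)). set (l := p1 (p2 (p2 N))).
  destruct (names_const X Y HX HY p T i Hp) as (r & Hr & Hd).
  pose proof (peval_sound p _ _ _ r l N (truncation_prefix p (2 * N + 2)) Hr) as Hs.
  set (e := peval _ _ _ _) in *. cbv zeta.
  destruct e as [|j] eqn:He; cbn [ifz]; [discriminate|].
  specialize (Hs ltac:(discriminate)). injection Hs as ->. cbn [Nat.pred].
  set (t := (_ - _)%nat). destruct t eqn:Et; cbn [ifz]; [|discriminate].
  intros [= <-]. exists (cb_alpha X i). unfold t in Et.
  assert (Hlt : (2 + p1 N * (dY (r l) 0 l + 3) < dX i 0 l)%nat) by lia.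
  apply lt_INR in Hlt. rewrite plus_INR, mult_INR, plus_INR in Hlt.
  specialize (AX i 0%nat l). specialize (AY (r l) 0%nat l). specialize (Hd l).
  rewrite cb_alpha_0, vdist_0_r in AX by apply HX.
  rewrite cb_alpha_0, vdist_0_r in AY by apply HY.
  apply Rabs_le_bounds in AX. apply Rabs_le_bounds in AY.
  destruct (vnorm_vdist_le _ (proj1 HY) (cb_alpha Y (r l)) (T (cb_alpha X i))) as [_ H].
  pose proof (pow_2_half l). assert (HP : 0 < 2 ^ l) by (apply pow_lt; lra).
  pose proof (pos_INR (p1 N)). change (INR 2) with 2 in Hlt.
  replace (INR 3) with 3 in Hlt by (simpl; ring).
  set (a := vnorm (cb_alpha X i)) in *. set (b := vnorm (cb_alpha Y (r l))) in *.
  set (c := vnorm (T (cb_alpha X i))) in *.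
  set (D2 := INR (dY _ _ _)) in *. set (D1 := INR (dX _ _ _)) in *.
  assert (2 ^ l * c <= 2 ^ l * b + 1) by nra.
  assert (INR (p1 N) * (2 ^ l * c) <= INR (p1 N) * (D2 + 3))
    by (apply Rmult_le_compat_l; lra).
  apply Rmult_lt_reg_l with (2 ^ l); [exact HP|]. lra.
Qed.

Lemma pow2_unbounded b : exists l : nat, b < 2 ^ l.
Proof.
  destruct (Rle_lt_dec b 0) as [H|H].
  - exists 0%nat. simpl. lra.
  - destruct (pow_half_small (/ b)) as [l Hl]; [now apply Rinv_0_lt_compat|].
    exists l. specialize (Hl l (le_n l)). pose proof (pow_2_half l).
    assert (HP : 0 < 2 ^ l) by (apply pow_lt; lra).
    apply Rmult_lt_reg_r with (/ b); [now apply Rinv_0_lt_compat|].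
    rewrite Rinv_r by lra. nra.
Qed.

Lemma non_bounds_complete (X Y : CBSpace) (HX : is_CBS X) (HY : is_CBS Y) dX dY p
    (T : cb_sp X -> cb_sp Y) n i :
  dist_approx X dX -> dist_approx Y dY -> names p T ->
  INR n * vnorm (T (cb_alpha X i)) < vnorm (cb_alpha X i) ->
  exists N, prefix_op (non_bounds dX dY) p N = S n.
Proof.
  intros [_ AX] [_ AY] Hp Hi.
  destruct (names_const X Y HX HY p T i Hp) as (r & Hr & Hd).
  set (a := vnorm (cb_alpha X i)) in *. set (c := vnorm (T (cb_alpha X i))) in *.
  (* At scale [2^l] the test loses at most [4 + 6 n] in all, so it succeeds once the gap [a - n c]
     is magnified beyond this. *)
  destruct (pow2_unbounded ((4 + 6 * INR n) / (a - INR n * c))) as [l Hl].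
  destruct (peval_complete p _ r l Hr) as [t0 Ht0].
  (* The last component is not read by the test; filled with [t0] it makes [N] large enough for the
     evaluation of the name to finish. *)
  set (N := to_nat (n, to_nat (i, to_nat (l, t0)))). exists N.
  assert (HN : (t0 <= N)%nat).
  { unfold N. eapply Nat.le_trans; [|apply to_nat_ge2].
    eapply Nat.le_trans; [|apply to_nat_ge2]. apply to_nat_ge2. }
  unfold prefix_op, non_bounds.
  assert (En : p1 N = n) by apply p1_to_nat.
  assert (Ei : p1 (p2 N) = i) by (unfold N; now rewrite p2_to_nat, p1_to_nat).
  assert (El : p1 (p2 (p2 N)) = l) by (unfold N; now rewrite !p2_to_nat, p1_to_nat).
  rewrite En, Ei, El. cbv zeta.
  rewrite (Ht0 N _ _ (truncation_prefix p (2 * N + 2))) by lia. cbn [ifz Nat.pred].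
  enough (Hlt : (2 + n * (dY (r l) 0 l + 3) < dX i 0 l)%nat).
  { replace (S _ - _)%nat with 0%nat by lia. reflexivity. }
  apply INR_lt. rewrite plus_INR, mult_INR, plus_INR.
  specialize (AX i 0%nat l). specialize (AY (r l) 0%nat l). specialize (Hd l).
  rewrite cb_alpha_0, vdist_0_r in AX by apply HX.
  rewrite cb_alpha_0, vdist_0_r in AY by apply HY.
  apply Rabs_le_bounds in AX. apply Rabs_le_bounds in AY.
  destruct (vnorm_vdist_le _ (proj1 HY) (cb_alpha Y (r l)) (T (cb_alpha X i))) as [H _].
  pose proof (pow_2_half l). assert (HP : 0 < 2 ^ l) by (apply pow_lt; lra).
  pose proof (pos_INR n). change (INR 2) with 2. replace (INR 3) with 3 by (simpl; ring).
  fold a in AX. fold c in H. set (b := vnorm (cb_alpha Y (r l))) in *.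
  set (D2 := INR (dY _ _ _)) in *. set (D1 := INR (dX _ _ _)) in *.
  assert (2 ^ l * b <= 2 ^ l * c + 1) by nra.
  assert (INR n * (D2 + 3) <= INR n * (2 ^ l * c + 6)) by (apply Rmult_le_compat_l; lra).
  apply Rmult_lt_compat_r with (r := a - INR n * c) in Hl; [|lra].
  replace (_ / _ * _) with (4 + 6 * INR n) in Hl by (field; lra). lra.
Qed.

(** A number that is never enumerated is known to be a bound on the dense sequence only; continuity
    of [T] extends the estimate. *)
Lemma bound_of_alpha (X Y : CBSpace) (HX : is_CBS X) (HY : is_CBS Y)
    (T : cb_sp X -> cb_sp Y) C :
  linear_map T -> (exists c, forall x, vnorm (T x) <= c * vnorm x) -> 0 <= C ->
  (forall i, vnorm (cb_alpha X i) <= C * vnorm (T (cb_alpha X i))) ->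
  forall x, vnorm x <= C * vnorm (T x).
Proof.
  intros [Tadd Tscal] [c Hc] HC H x. apply le_epsilon. intros eps He.
  pose proof (Rabs_pos c) as Hcp.
  destruct (cb_alpha_dense X HX x (eps / (1 + C * Rabs c))) as [i Hi].
  { apply Rdiv_lt_0_compat; [lra|nra]. }
  specialize (H i). specialize (Hc (vadd (cb_alpha X i) (vscal (-1) x))).
  rewrite Tadd, Tscal in Hc. change (vnorm (vadd ?u (vscal (-1) ?v))) with (vdist u v) in Hc.
  pose proof (vnorm_vdist_le _ (proj1 HX) (cb_alpha X i) x).
  pose proof (vnorm_vdist_le _ (proj1 HY) (T (cb_alpha X i)) (T x)).
  set (d := vdist (cb_alpha X i) x) in *. set (d' := vdist (T (cb_alpha X i)) (T x)) in *.
  assert (0 <= d) by (apply vdist_nonneg, HX).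
  assert (c * d <= Rabs c * d) by (apply Rmult_le_compat_r; [lra|apply Rle_abs]).
  assert (HD : 0 < 1 + C * Rabs c) by nra.
  apply Rmult_lt_compat_r with (r := 1 + C * Rabs c) in Hi; [|exact HD].
  replace (eps / _ * _) with eps in Hi by (field; lra).
  assert (C * d' <= C * (Rabs c * d)) by (apply Rmult_le_compat_l; lra).
  assert (C * vnorm (T (cb_alpha X i)) <= C * (vnorm (T x) + d'))
    by (apply Rmult_le_compat_l; lra).
  lra.
Qed.

(** The bound gives [|alpha_i - S' y| <= n |T alpha_i - y|]. The test certifies
    [|T alpha_i - y| <= 1 / ((n+1) 2^(k+1))]: its summand 4 is 2 for [dist_approx] and 1 each for
    the names of [T alpha_i] and of [y]. The factor [n+1] is positive also for [n = 0]. *)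
Lemma inverse_name_correct (X Y : CBSpace) (HX : is_CBS X) (HY : is_CBS Y) dY p s
    (T : cb_sp X -> cb_sp Y) (S' : cb_sp Y -> cb_sp X) :
  dist_approx Y dY -> names p T -> linear_map T ->
  (exists c, forall x, vnorm (T x) <= c * vnorm x) ->
  (forall x, vnorm x <= INR (s 0%nat) * vnorm (T x)) ->
  (forall y, T (S' y) = y) ->
  names (prefix_op (inverse_name dY) (bpair p s)) S'.
Proof.
  intros [_ AY] Hp [Tadd Tscal] [c Hc] Hs HS q y Hq.
  set (n := s 0%nat) in *. pose proof (pos_INR n) as Hn0.
  assert (HqY := fun l => cauchy_rep_dist Y (proj1 HY) q y l Hq).
  assert (Hsn : forall N, cnth 1 (code_list (prefix (bpair p s) (2 * N + 2))) = n).
  { intro N. rewrite cnth_code_list, nth_prefix.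
    destruct (Nat.ltb_spec 1 (2 * N + 2)); [reflexivity|lia]. }
  assert (HM : forall k, 0 < INR (S n) * 2 ^ S k).
  { intro k. pose proof (INR_S_pos n). assert (0 < 2 ^ S k) by (apply pow_lt; lra). nra. }
  assert (Hdist : forall i, vdist (cb_alpha X i) (S' y)
            <= INR n * vdist (T (cb_alpha X i)) y).
  { intro i. unfold vdist at 1. eapply Rle_trans; [apply Hs|].
    rewrite Tadd, Tscal, HS. apply Rle_refl. }
  set (P := prefix_op (inverse_name dY) (bpair p s)).
  assert (Hsound : forall k m i, P (code_nw k (prefix q m)) = S i ->
            vdist (cb_alpha X i) (S' y) <= (/ 2) ^ S k).
  { intros k m i. unfold P, prefix_op, inverse_name.
    set (N := code_nw k (prefix q m)). intro HN.
    destruct (first_nz_sound (inverse_test dY N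
                (code_list (prefix (bpair p s) (2 * N + 2)))) N) as (z & _ & E & _);
      [rewrite HN; discriminate|].
    rewrite E in HN. revert HN. unfold inverse_test. rewrite Hsn.
    assert (E1 : p1 N = k) by apply p1_to_nat.
    assert (E2 : p2 N = code_list (prefix q m)) by apply p2_to_nat.
    rewrite E1, E2, clen_code_list, length_prefix, cnth_code_list, nth_prefix. cbv zeta.
    set (l := p2 z). set (t := (S l - m)%nat). destruct t eqn:Et; cbn [ifz]; [|discriminate].
    unfold t in Et. replace (l <? m)%nat with true by (symmetry; apply Nat.ltb_lt; lia).
    destruct (names_const X Y HX HY p T (p1 z) Hp) as (r & Hr & Hd).
    pose proof (peval_sound p _ _ _ r l N (truncation_bpair p s N) Hr) as He.
    set (e := peval _ _ _ _) in *.
    destruct e as [|j] eqn:Ee; cbn [ifz]; [discriminate|].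
    specialize (He ltac:(discriminate)). injection He as ->. cbn [Nat.pred].
    set (t' := (_ - 2 ^ l)%nat). destruct t' eqn:Et'; cbn [ifz]; [|discriminate].
    intros [= <-]. unfold t' in Et'.
    assert (Hle : ((dY (r l) (q l) l + 4) * (S n * 2 ^ S k) <= 2 ^ l)%nat) by lia.
    apply le_INR in Hle. rewrite !mult_INR, plus_INR, !pow_INR in Hle.
    change (INR 2) with 2 in Hle. replace (INR 4) with 4 in Hle by (simpl; ring).
    specialize (Hdist (p1 z)). specialize (AY (r l) (q l) l). apply Rabs_le_bounds in AY.
    specialize (Hd l). specialize (HqY l). specialize (HM k).
    pose proof (vdist_triangle _ (proj1 HY) (T (cb_alpha X (p1 z))) (cb_alpha Y (r l)) y) as T1.
    pose proof (vdist_triangle _ (proj1 HY) (cb_alpha Y (r l)) (cb_alpha Y (q l)) y) as T2.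
    rewrite (vdist_sym _ (proj1 HY) (T _) (cb_alpha Y (r l))) in T1.
    set (D := INR (dY _ _ _)) in *. set (M := INR (S n) * 2 ^ S k) in *.
    set (d := vdist (T _) y) in *.
    pose proof (pow_2_half l). assert (HP : 0 < 2 ^ l) by (apply pow_lt; lra).
    assert (0 <= d) by (apply vdist_nonneg, HY).
    assert (Hd4 : 2 ^ l * d <= D + 4) by nra.
    assert (HdM : d * M <= 1).
    { apply Rmult_le_reg_l with (2 ^ l); [exact HP|].
      assert (2 ^ l * d * M <= (D + 4) * M) by (apply Rmult_le_compat_r; lra). lra. }
    eapply Rle_trans; [exact Hdist|]. unfold M in HdM. rewrite S_INR in HdM.
    assert (H2 : 0 < 2 ^ S k) by (apply pow_lt; lra). pose proof (pow_2_half (S k)).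
    apply Rmult_le_reg_r with (2 ^ S k); [exact H2|]. nra. }
  assert (Hcomplete : forall k, exists m, P (code_nw k (prefix q m)) <> 0%nat).
  { intro k. set (M := INR (S n) * 2 ^ S k). specialize (HM k). fold M in HM.
    pose proof (Rabs_pos c) as Hcp.
    (* This choice yields [d M <= 1/2] for [d = |T alpha_i - y|]. Together with [16 M < 2^l] it
       gives [(8 + 2^l d) M <= 2^l], where 8 is the summand 4 of the test plus 4 for the errors of
       the approximated distance. *)
    destruct (cb_alpha_dense X HX (S' y) (/ (2 * M) / (Rabs c + 1))) as [i Hi].
    { apply Rdiv_lt_0_compat; [apply Rinv_0_lt_compat|]; lra. }
    destruct (pow2_unbounded (16 * M)) as [l Hl].
    destruct (names_const X Y HX HY p T i Hp) as (r & Hr & Hd).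
    destruct (peval_complete p _ r l Hr) as [t0 Ht0].
    (* The prefix must contain [q l], and its code, which also bounds the search and the evaluation,
       must exceed [z] and [t0]. *)
    set (z := to_nat (i, l)). set (m := (S t0 + S z + S l)%nat). exists m.
    unfold P, prefix_op, inverse_name. set (N := code_nw k (prefix q m)).
    assert (HN : (m <= N)%nat) by apply code_nw_prefix_ge.
    apply first_nz_complete with z; [lia|]. unfold inverse_test. rewrite Hsn.
    assert (E1 : p1 N = k) by apply p1_to_nat.
    assert (E2 : p2 N = code_list (prefix q m)) by apply p2_to_nat.
    assert (E3 : p1 z = i) by apply p1_to_nat. assert (E4 : p2 z = l) by apply p2_to_nat.
    rewrite E1, E2, E3, E4, clen_code_list, length_prefix, cnth_code_list, nth_prefix.
    cbv zeta. rewrite (Ht0 N _ _ (truncation_bpair p s N)) by lia.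
    replace (l <? m)%nat with true by (symmetry; apply Nat.ltb_lt; lia).
    replace (S l - m)%nat with 0%nat by lia. cbn [ifz Nat.pred].
    enough (Hle : ((dY (r l) (q l) l + 4) * (S n * 2 ^ S k) <= 2 ^ l)%nat).
    { replace (_ - 2 ^ l)%nat with 0%nat by lia. discriminate. }
    apply INR_le. rewrite !mult_INR, plus_INR, !pow_INR.
    change (INR 2) with 2. replace (INR 4) with 4 by (simpl; ring). fold M.
    specialize (AY (r l) (q l) l). apply Rabs_le_bounds in AY.
    specialize (Hd l). specialize (HqY l).
    pose proof (vdist_triangle _ (proj1 HY) (cb_alpha Y (r l)) (T (cb_alpha X i))
                  (cb_alpha Y (q l))) as T1.
    pose proof (vdist_triangle _ (proj1 HY) (T (cb_alpha X i)) y (cb_alpha Y (q l))) as T2.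
    rewrite (vdist_sym _ (proj1 HY) y) in T2.
    specialize (Hc (vadd (cb_alpha X i) (vscal (-1) (S' y)))).
    rewrite Tadd, Tscal, HS in Hc.
    change (vnorm (vadd ?u (vscal (-1) ?v))) with (vdist u v) in Hc.
    set (D := INR (dY _ _ _)) in *. set (d := vdist (T _) y) in *.
    set (d0 := vdist _ (S' y)) in *.
    pose proof (pow_2_half l). assert (HP : 0 < 2 ^ l) by (apply pow_lt; lra).
    assert (0 <= d0) by (apply vdist_nonneg, HX).
    assert (c * d0 <= Rabs c * d0) by (apply Rmult_le_compat_r; [lra|apply Rle_abs]).
    apply Rmult_lt_compat_r with (r := Rabs c + 1) in Hi; [|lra].
    replace (_ / _ * _) with (/ (2 * M)) in Hi by (field; lra).
    assert (HdM : d * M <= / 2).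
    { apply Rle_trans with (/ (2 * M) * M); [|apply Req_le; field; lra].
      apply Rmult_le_compat_r; lra. }
    assert (HD : D + 4 <= 8 + 2 ^ l * d) by nra.
    apply Rle_trans with ((8 + 2 ^ l * d) * M); [apply Rmult_le_compat_r; lra|]. nra. }
  destruct (eta_defined P q Hcomplete) as [r Hr]. exists r. split; [exact Hr|].
  apply cauchy_rep_intro; [apply HX|]. intro k.
  destruct (eta_value P q r k Hr) as [m Hm]. exact (Hsound k m (r k) Hm).
Qed.

Theorem IMT_le_CN (X Y : CBSpace) (HX : is_CBS X) (HY : is_CBS Y) :
  weih_le (IMT X Y) CN.
Proof.
  destruct (dist_approx_exists X HX) as [dX HdX].
  destruct (dist_approx_exists Y HY) as [dY HdY].
  exists (fun p r => r = prefix_op (inverse_name dY) p).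
  exists (fun p r => r = prefix_op (non_bounds dX dY) p).
  split; [apply computable_prefix_op, tr_inverse_name, HdY|].
  split; [apply computable_prefix_op, tr_non_bounds; [apply HdX|apply HdY]|].
  intros G [Gfun HG]. split.
  - intros p q q' (k & s & -> & Hs & ->) (k' & s' & -> & Hs' & ->).
    now rewrite (Gfun _ _ _ Hs Hs').
  - intros p T Hp [S0 [HT HS0]].
    destruct HT as (Tadd & Tscal & Tbd & Tinj & Tsurj).
    set (k := prefix_op (non_bounds dX dY) p).
    (* The set is decided classically, but only its name [k] enters the reduction. *)
    pose (A := fun n => if excluded_middle_informative (exists N, k N = S n)
                        then false else true).
    assert (HA : rep RAminus k A).
    { intro n. unfold A. destruct (excluded_middle_informative _) as [h|h];
        split; auto; [discriminate|contradiction]. }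
    assert (HAne : exists n, CN A n).
    { destruct (bounded_inverse _ _ (proj1 HX) (proj1 HY) T (conj Tadd Tscal) Tbd Tinj Tsurj)
        as [n Hn].
      assert (HAn : A n = true).
      { unfold A. destruct (excluded_middle_informative _) as [[N HN]|h]; [|reflexivity].
        destruct (non_bounds_sound X Y HX HY dX dY p T N n HdX HdY Hp HN) as [x Hx].
        specialize (Hn x). lra. }
      exists n. split; [now exists n|exact HAn]. }
    destruct (HG k A HA HAne) as [[s Hs] Hall]. split.
    + exists (prefix_op (inverse_name dY) (bpair p s)), k, s. auto.
    + intros q (k' & s' & -> & Hs' & ->). exists S0.
      assert (s' = s) as -> by exact (Gfun _ _ _ Hs' Hs).
      split; [|split; [repeat split; assumption|exact HS0]].
      destruct (Hall s Hs) as (n & Hn & _ & HAn). cbn in Hn.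
      apply (inverse_name_correct X Y HX HY dY p s T S0 HdY Hp (conj Tadd Tscal) Tbd);
        [|exact HS0].
      rewrite Hn.
      apply (bound_of_alpha X Y HX HY T (INR n) (conj Tadd Tscal) Tbd (pos_INR n)).
      intro i. apply Rnot_lt_le. intro Hi.
      destruct (non_bounds_complete X Y HX HY dX dY p T n i HdX HdY Hp Hi) as [N HN].
      unfold A in HAn. destruct (excluded_middle_informative _) as [h|h]; [discriminate|].
      apply h. now exists N.
Qed.

(** * The computable Banach space l2 *)

Definition co (x : l2car) (n : nat) : R := proj1_sig x n.

Lemma l2_ext (x y : l2car) : (forall n, co x n = co y n) -> x = y.
Proof.
  destruct x as [x Hx], y as [y Hy]. unfold co. cbn [proj1_sig]. intro H.
  assert (x = y) as -> by (apply functional_extensionality; exact H).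
  f_equal. apply proof_irrelevance.
Qed.

Definition sq_sum (x : nat -> R) (N : nat) : R := sum_f_R0 (fun n => x n ^ 2) N.

Lemma l2_norm_nonneg x : 0 <= l2_norm x.
Proof. apply sqrt_pos. Qed.

Lemma sq_sum_nonneg x N : 0 <= sq_sum x N.
Proof. apply cond_pos_sum. intro n. apply pow2_ge_0. Qed.

(** Upper and lower estimates of the norm are drawn from this characterisation, so only finite sums
    have to be manipulated. *)
Lemma l2_norm_lub x : is_lub (l2_partial x) (l2_norm x ^ 2).
Proof.
  unfold l2_norm. destruct (completeness _ _ _) as [m Hm]. cbn [proj1_sig].
  rewrite pow2_sqrt; [exact Hm|].
  eapply Rle_trans; [apply (sq_sum_nonneg (proj1_sig x) 0)|].
  apply Hm. now exists 0%nat.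
Qed.

Lemma sq_sum_le_l2_norm x N : sq_sum (co x) N <= l2_norm x ^ 2.
Proof. apply l2_norm_lub. now exists N. Qed.

Lemma l2_norm_le x B : 0 <= B -> (forall N, sq_sum (co x) N <= B ^ 2) -> l2_norm x <= B.
Proof.
  intros HB H. apply Rsqr_incr_0_var; [|exact HB]. rewrite !Rsqr_pow2.
  apply l2_norm_lub. intros r [N ->]. apply H.
Qed.

Lemma sq_le_sq_sum x n : x n ^ 2 <= sq_sum x n.
Proof.
  destruct n as [|n]; [apply Rle_refl|]. unfold sq_sum. cbn [sum_f_R0].
  pose proof (sq_sum_nonneg x n) as H. unfold sq_sum in H. lra.
Qed.

Lemma co_le_l2_norm x n : Rabs (co x n) <= l2_norm x.
Proof.
  apply Rsqr_incr_0_var; [|apply l2_norm_nonneg]. rewrite <- Rsqr_abs, !Rsqr_pow2.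
  eapply Rle_trans; [apply sq_le_sq_sum|apply sq_sum_le_l2_norm].
Qed.

Lemma sq_sum_le x y N :
  (forall n, Rabs (x n) <= Rabs (y n)) -> sq_sum x N <= sq_sum y N.
Proof.
  intro H. apply sum_Rle. intros n _. rewrite <- !Rsqr_pow2. now apply Rsqr_le_abs_1.
Qed.

Lemma l2_norm_mono x y :
  (forall n, Rabs (co x n) <= Rabs (co y n)) -> l2_norm x <= l2_norm y.
Proof.
  intro H. apply l2_norm_le; [apply l2_norm_nonneg|]. intro N.
  eapply Rle_trans; [now apply sq_sum_le|apply sq_sum_le_l2_norm].
Qed.

Lemma l2_norm_scal_le a x : l2_norm (l2_scal a x) <= Rabs a * l2_norm x.
Proof.
  apply l2_norm_le.
  - apply Rmult_le_pos; [apply Rabs_pos|apply l2_norm_nonneg].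
  - intro N. rewrite Rpow_mult_distr, pow2_abs.
    replace (sq_sum (co (l2_scal a x)) N) with (a ^ 2 * sq_sum (co x) N).
    + apply Rmult_le_compat_l; [apply pow2_ge_0|apply sq_sum_le_l2_norm].
    + unfold sq_sum. rewrite <- sum_scal_l. apply sum_eq. intros n _. unfold co. cbn. ring.
Qed.

(** For [a <> 0] the missing inequality is [l2_norm_scal_le] for the scalar [/ a] and the vector
    [a x]. *)
Lemma l2_norm_scal a x : l2_norm (l2_scal a x) = Rabs a * l2_norm x.
Proof.
  apply Rle_antisym; [apply l2_norm_scal_le|].
  destruct (Req_dec a 0) as [->|Ha].
  - rewrite Rabs_R0, Rmult_0_l. apply l2_norm_nonneg.
  - pose proof (Rabs_pos_lt a Ha) as Hp.
    apply Rmult_le_reg_l with (/ Rabs a); [now apply Rinv_0_lt_compat|].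
    rewrite <- Rmult_assoc, Rinv_l, Rmult_1_l by lra. rewrite <- Rabs_inv.
    replace x with (l2_scal (/ a) (l2_scal a x)) at 1; [apply l2_norm_scal_le|].
    apply l2_ext. intro n. unfold co. cbn. field. exact Ha.
Qed.

(* For [a > |x|] and [b > |y|] the convexity estimate
   [(s+t)^2 <= (a+b)(s^2/a + t^2/b)] sums to [|x+y|^2 <= (a+b)^2]. *)
Lemma l2_norm_triangle x y : l2_norm (l2_add x y) <= l2_norm x + l2_norm y.
Proof.
  apply le_epsilon. intros eps He.
  set (a := l2_norm x + eps / 2). set (b := l2_norm y + eps / 2).
  pose proof (l2_norm_nonneg x) as Hx. pose proof (l2_norm_nonneg y) as Hy.
  assert (Ha : 0 < a) by (unfold a; lra). assert (Hb : 0 < b) by (unfold b; lra).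
  replace (l2_norm x + l2_norm y + eps) with (a + b) by (unfold a, b; lra).
  apply l2_norm_le; [lra|]. intro N.
  apply Rle_trans with
    ((a + b) / a * sq_sum (co x) N + (a + b) / b * sq_sum (co y) N).
  - unfold sq_sum. rewrite <- !sum_scal_l, <- plus_sum. apply sum_Rle. intros n _.
    change (co (l2_add x y) n) with (co x n + co y n).
    set (s := co x n). set (t := co y n).
    replace ((a + b) / a * s ^ 2 + (a + b) / b * t ^ 2)
      with ((s + t) ^ 2 + (b * s - a * t) ^ 2 * / (a * b)) by (field; lra).
    assert (0 <= (b * s - a * t) ^ 2 * / (a * b)); [|lra].
    apply Rmult_le_pos; [apply pow2_ge_0|]. left. apply Rinv_0_lt_compat. nra.
  - pose proof (sq_sum_le_l2_norm x N) as H1. pose proof (sq_sum_le_l2_norm y N) as H2.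
    assert (H1' : sq_sum (co x) N <= a ^ 2) by (unfold a; nra).
    assert (H2' : sq_sum (co y) N <= b ^ 2) by (unfold b; nra).
    apply Rle_trans with ((a + b) / a * a ^ 2 + (a + b) / b * b ^ 2).
    + assert (0 < (a + b) / a) by (apply Rdiv_lt_0_compat; lra).
      assert (0 < (a + b) / b) by (apply Rdiv_lt_0_compat; lra).
      apply Rplus_le_compat; apply Rmult_le_compat_l; lra.
    + apply Req_le. field. lra.
Qed.

Lemma l2_norm_eq0 x : l2_norm x = 0 -> x = l2_zero.
Proof.
  intro H. apply l2_ext. intro n. pose proof (co_le_l2_norm x n) as Hn. rewrite H in Hn.
  change (co l2_zero n) with 0. apply Rabs_le_bounds in Hn. lra.
Qed.

Lemma Un_cv_le_bound (u : nat -> R) l B N :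
  Un_cv u l -> (forall k, (k >= N)%nat -> u k <= B) -> l <= B.
Proof.
  intros Hu H. apply le_epsilon. intros eps He. destruct (Hu eps He) as [M HM].
  specialize (HM (Nat.max M N) ltac:(lia)). specialize (H (Nat.max M N) ltac:(lia)).
  unfold Rdist in HM. apply Rabs_def2 in HM. lra.
Qed.

Lemma Un_cv_sq_sum (c : nat -> R) (v : nat -> nat -> R) (w : nat -> R) K :
  (forall n, Un_cv (fun k => v k n) (w n)) ->
  Un_cv (fun k => sq_sum (fun n => c n + -1 * v k n) K)
        (sq_sum (fun n => c n + -1 * w n) K).
Proof.
  intro H.
  assert (H1 : forall n, Un_cv (fun k => (c n + -1 * v k n) ^ 2) ((c n + -1 * w n) ^ 2)).
  { intro n. assert (Hc : forall r : R, Un_cv (fun _ => r) r).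
    { intros r eps He. exists 0%nat. intros. unfold Rdist.
      rewrite Rminus_diag, Rabs_R0. exact He. }
    assert (H2 : Un_cv (fun k => c n + -1 * v k n) (c n + -1 * w n)).
    { apply (CV_plus (fun _ => c n)); [apply Hc|].
      apply (CV_mult (fun _ => -1)); [apply Hc|apply H]. }
    simpl pow. apply (CV_mult _ _ _ _ H2). apply (CV_mult _ _ _ _ H2). apply Hc. }
  unfold sq_sum. induction K as [|K IH]; cbn [sum_f_R0]; [apply H1|].
  apply CV_plus; [exact IH|apply H1].
Qed.

(** The limit [w] is taken coordinatewise. A bound on the partial sums of [u_m - u_k] survives the
    limit in [k], uniformly in the length of the sum; this shows that [u_m - w], hence [w], is
    square-summable, and that [u] converges to it in norm. *)
Lemma l2_complete (u : nat -> l2car) :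
  (forall eps, eps > 0 -> exists N, forall m n, (m >= N)%nat -> (n >= N)%nat ->
     l2_norm (l2_add (u m) (l2_scal (-1) (u n))) < eps) ->
  exists x, forall eps, eps > 0 -> exists N, forall n, (n >= N)%nat ->
     l2_norm (l2_add (u n) (l2_scal (-1) x)) < eps.
Proof.
  intro Hu.
  assert (Hcv : forall n, exists l, Un_cv (fun k => co (u k) n) l).
  { intro n. destruct (R_complete (fun k => co (u k) n)) as [l Hl]; [|now exists l].
    intros eps He. destruct (Hu eps He) as [N HN]. exists N. intros k m Hk Hm.
    eapply Rle_lt_trans; [|exact (HN k m Hk Hm)].
    eapply Rle_trans; [|apply (co_le_l2_norm _ n)]. apply Req_le. unfold Rdist.
    f_equal. unfold co. cbn. ring. }
  destruct (fun_choice _ _ _ Hcv) as [w Hw].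
  assert (Hb : forall eps, eps > 0 -> exists N, forall m, (m >= N)%nat -> forall K,
             sq_sum (fun n => co (u m) n + -1 * w n) K <= eps ^ 2).
  { intros eps He. destruct (Hu eps He) as [N HN]. exists N. intros m Hm K.
    apply (Un_cv_le_bound _ _ _ N (Un_cv_sq_sum (co (u m)) (fun k => co (u k)) w K Hw)).
    intros k Hk. specialize (HN m k Hm Hk).
    pose proof (sq_sum_le_l2_norm (l2_add (u m) (l2_scal (-1) (u k))) K) as H.
    pose proof (l2_norm_nonneg (l2_add (u m) (l2_scal (-1) (u k)))).
    eapply Rle_trans; [exact H|]. apply pow_incr. lra. }
  assert (Hsw : sq_summable w).
  { destruct (Hb 1 ltac:(lra)) as [N HN]. specialize (HN N (le_n N)).
    assert (Hd : sq_summable (fun n => co (u N) n + -1 * w n)) by (now exists (1 ^ 2)).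
    pose proof (sq_summable_add _ _ (proj2_sig (u N)) (sq_summable_scal (-1) _ Hd)) as H.
    replace w with (fun n => proj1_sig (u N) n + -1 * (co (u N) n + -1 * w n)); [exact H|].
    apply functional_extensionality. intro n. unfold co. ring. }
  exists (exist _ w Hsw). intros eps He. destruct (Hb (eps / 2) ltac:(lra)) as [N HN].
  exists N. intros n Hn. apply Rle_lt_trans with (eps / 2); [|lra].
  apply l2_norm_le; [lra|]. exact (HN n Hn).
Qed.

Lemma l2_banach : is_banach l2_space.
Proof.
  repeat split.
  - intros x y z. apply l2_ext. intro n. unfold co. cbn. ring.
  - intros x y. apply l2_ext. intro n. unfold co. cbn. ring.
  - intros x. apply l2_ext. intro n. unfold co. cbn. ring.
  - intros x. apply l2_ext. intro n. unfold co. cbn. ring.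
  - intros x. apply l2_ext. intro n. unfold co. cbn. ring.
  - intros a b x. apply l2_ext. intro n. unfold co. cbn. ring.
  - intros a b x. apply l2_ext. intro n. unfold co. cbn. ring.
  - intros a x y. apply l2_ext. intro n. unfold co. cbn. ring.
  - exact l2_norm_eq0.
  - exact l2_norm_scal.
  - exact l2_norm_triangle.
  - exact l2_complete.
Qed.

Lemma co_lincomb l : forall k n,
  co (lincomb (V := l2_space) l2_basis k l) n
  = if (n <? k)%nat then 0 else nth (n - k) l 0.
Proof.
  induction l as [|c l IH]; intros k n.
  - destruct (n <? k)%nat; [reflexivity|]. destruct (n - k)%nat; reflexivity.
  - cbn [lincomb].
    transitivity (c * co (l2_basis k) n + co (lincomb (V := l2_space) l2_basis (S k) l) n);
      [reflexivity|].
    rewrite IH. change (co (l2_basis k) n) with (if Nat.eqb n k then 1 else 0).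
    destruct (Nat.eqb_spec n k), (Nat.ltb_spec n (S k)), (Nat.ltb_spec n k); try lia.
    + replace (n - k)%nat with 0%nat by lia. cbn [nth]. ring.
    + ring.
    + replace (n - k)%nat with (S (n - S k)) by lia. cbn [nth]. ring.
Qed.

(** * Computing distances of finite rational sequences *)

Definition qval (k : nat) : R := Q2R (nat_to_Q k).

(** Makes the default 0 of [cnth] agree with the vanishing coordinates beyond the end of a finite
    sequence. *)
Lemma qval_0 : qval 0 = 0.
Proof.
  unfold qval. rewrite Q2R_nat_to_Q. change 0%nat with (to_nat (0, 0))%nat.
  rewrite p1_to_nat. simpl. unfold Rdiv. ring.
Qed.

Lemma co_alpha c n : co (cb_alpha l2 c) n = qval (cnth n c).
Proof.
  unfold cb_alpha. change (cb_e l2) with l2_basis. rewrite co_lincomb. cbn [Nat.ltb Nat.leb].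
  rewrite Nat.sub_0_r, <- qval_0.
  change (fun k => Q2R (nat_to_Q k)) with qval. rewrite map_nth.
  now rewrite <- cnth_code_list, code_decode_list.
Qed.

(** The numerator is kept as a difference of two natural numbers, of which one is zero according to
    the parity of its code. *)
Definition qpos (c : nat) : nat :=
  let a := p1 c in ifz (a - 2 * quot a 2) (quot a 2) 0.
Definition qneg (c : nat) : nat :=
  let a := p1 c in ifz (a - 2 * quot a 2) 0 (quot (S a) 2).
Definition qden (c : nat) : nat := S (p2 c).

Lemma qval_spec c : qval c = (INR (qpos c) - INR (qneg c)) / INR (qden c).
Proof.
  unfold qval, qpos, qneg, qden. rewrite Q2R_nat_to_Q. f_equal.
  destruct (quot_spec (p1 c) 2) as [H1 H2]; [lia|].
  destruct (quot_spec (S (p1 c)) 2) as [H3 H4]; [lia|].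
  destruct (Nat.even (p1 c)) eqn:Ev.
  - apply Nat.even_spec in Ev as [m Em]. rewrite Em in *. rewrite Nat.div2_double.
    assert (quot (2 * m) 2 = m) as -> by lia. rewrite Nat.sub_diag.
    cbn [ifz]. change (INR 0) with 0. ring.
  - assert (Ho : Nat.odd (p1 c) = true) by (unfold Nat.odd; now rewrite Ev).
    apply Nat.odd_spec in Ho as [m Em].
    replace (S (p1 c)) with (2 * S m)%nat in * by lia. rewrite Nat.div2_double.
    assert (quot (2 * S m) 2 = S m) as -> by lia.
    replace (p1 c - 2 * quot (p1 c) 2)%nat with 1%nat by lia.
    cbn [ifz]. change (INR 0) with 0. ring.
Qed.

Lemma qden_pos c : 0 < INR (qden c).
Proof. apply INR_S_pos. Qed.

(* One of the two truncated differences vanishes. *)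
Lemma INR_absdiff_sq u v :
  INR (((u - v) + (v - u)) ^ 2) = (INR u - INR v) ^ 2.
Proof.
  rewrite pow_INR, plus_INR. destruct (Nat.le_ge_cases u v).
  - replace (u - v)%nat with 0%nat by lia. rewrite minus_INR by assumption. simpl. ring.
  - replace (v - u)%nat with 0%nat by lia. rewrite minus_INR by assumption. simpl. ring.
Qed.

(** After cross-multiplication, [u] collects the positive and [v] the negative terms of the
    numerator of the difference; one of the two truncated subtractions gives its absolute value. *)
Definition diff_num (a c : nat) : nat :=
  (let u := qpos a * qden c + qneg c * qden a in
   let v := qpos c * qden a + qneg a * qden c in
   ((u - v) + (v - u)) ^ 2)%nat.
Definition diff_den (a c : nat) : nat := ((qden a * qden c) ^ 2)%nat.

Lemma diff_spec a c :
  INR (diff_num a c) = (qval a + -1 * qval c) ^ 2 * INR (diff_den a c).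
Proof.
  unfold diff_num, diff_den. rewrite INR_absdiff_sq, pow_INR, !plus_INR, !mult_INR.
  rewrite !qval_spec. pose proof (qden_pos a). pose proof (qden_pos c). field. lra.
Qed.

(** The sum of the first [K] squared coordinate differences as an unreduced fraction, coded by its
    numerator and denominator. *)
Definition sum_frac (i j K : nat) : nat :=
  (nat_rect (fun _ => nat) (to_nat (0, 1))
    (fun s r => to_nat (p1 r * diff_den (cnth s i) (cnth s j)
                        + diff_num (cnth s i) (cnth s j) * p2 r,
                        p2 r * diff_den (cnth s i) (cnth s j))) K)%nat.

Definition l2_diff (i j n : nat) : R := qval (cnth n i) + -1 * qval (cnth n j).

Lemma diff_den_pos a c : (0 < diff_den a c)%nat.
Proof. unfold diff_den, qden. simpl. lia. Qed.

Lemma sum_frac_spec i j K :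
  (0 < p2 (sum_frac i j (S K)))%nat /\
  INR (p1 (sum_frac i j (S K)))
  = sq_sum (l2_diff i j) K * INR (p2 (sum_frac i j (S K))).
Proof.
  unfold sum_frac, sq_sum. induction K as [|K [IH1 IH2]].
  - cbn [nat_rect sum_f_R0]. rewrite !p1_to_nat, !p2_to_nat.
    pose proof (diff_den_pos (cnth 0 i) (cnth 0 j)). split; [lia|].
    rewrite Nat.mul_0_l, Nat.add_0_l, Nat.mul_1_l, Nat.mul_1_r. apply diff_spec.
  - remember (S K) as K'. cbn [nat_rect]. rewrite !p1_to_nat, !p2_to_nat.
    set (r := nat_rect _ _ _ K') in *.
    pose proof (diff_den_pos (cnth K' i) (cnth K' j)). split; [nia|].
    rewrite plus_INR, !mult_INR, IH2, diff_spec.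
    replace (sum_f_R0 _ K') with (sum_f_R0 (fun n => l2_diff i j n ^ 2) K + l2_diff i j K' ^ 2)
      by now rewrite HeqK'.
    unfold l2_diff. ring.
Qed.

(** The integer part of [2^n sqrt(num/den)], as [m <= 2^n sqrt(num/den)] means [m^2 den <= 4^n num].
    The range [4^n num] is large enough because [den >= 1]. *)
Definition sqrt_approx (num den n : nat) : nat :=
  greatest (fun m => m * m * den - 4 ^ n * num)%nat (4 ^ n * num).

Lemma sqrt_approx_spec num den n s :
  (0 < den)%nat -> 0 <= s -> INR num = s * INR den ->
  Rabs (sqrt s - INR (sqrt_approx num den n) / 2 ^ n) <= (/ 2) ^ n.
Proof.
  intros Hden Hs Hnum. unfold sqrt_approx.
  set (P := fun m => (m * m * den - 4 ^ n * num)%nat).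
  destruct (greatest_spec P (4 ^ n * num) eq_refl) as [H1 H2].
  unfold P in H1, H2 at 2. fold P in H1. set (m := greatest P _) in *.
  assert (H3 : (m * m * den <= 4 ^ n * num)%nat) by lia.
  assert (H4 : (4 ^ n * num < S m * S m * den)%nat).
  { destruct H2 as [H2|H2]; [rewrite H2|lia]. nia. }
  clear H1 H2. apply le_INR in H3. apply lt_INR in H4.
  rewrite !mult_INR, pow_INR, Hnum in H3, H4. rewrite (S_INR m) in H4.
  assert (E4 : INR 4 = 4) by (simpl; ring). rewrite E4 in H3, H4.
  apply lt_INR in Hden. change (INR 0) with 0 in Hden.
  assert (E4n : 4 ^ n = 2 ^ n * 2 ^ n) by (rewrite <- Rpow_mult_distr; f_equal; ring).
  rewrite E4n in H3, H4.
  set (q := sqrt s). assert (Hq : s = q * q) by (symmetry; now apply sqrt_sqrt).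
  assert (Hq0 : 0 <= q) by apply sqrt_pos. rewrite Hq in H3, H4.
  pose proof (pow_2_half n) as Hh. assert (HP : 0 < 2 ^ n) by (apply pow_lt; lra).
  pose proof (pos_INR m) as Hm.
  assert (H5 : INR m <= 2 ^ n * q).
  { apply Rsqr_incr_0_var; [|nra]. unfold Rsqr.
    apply Rmult_le_reg_r with (INR den); [exact Hden|]. lra. }
  assert (H6 : 2 ^ n * q < INR m + 1).
  { apply Rsqr_incrst_0; [|nra|lra]. unfold Rsqr.
    apply Rmult_lt_reg_r with (INR den); [exact Hden|]. lra. }
  replace (INR m / 2 ^ n) with (INR m * (/ 2) ^ n)
    by (rewrite pow_inv; reflexivity).
  apply Rabs_le. pose proof (pow_half_pos n).
  set (h := (/ 2) ^ n) in *. clearbody h.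
  replace q with (2 ^ n * q * h) by (rewrite (Rmult_comm (2 ^ n)), Rmult_assoc, Hh; ring).
  nra.
Qed.

(** Lists are no longer than their codes. Thus [i + j] is a computable bound on the support, and the
    norm of the difference is the root of a finite sum. *)
Lemma l2_diff_zero i j n : (i + j <= n)%nat -> l2_diff i j n = 0.
Proof.
  intro H. unfold l2_diff.
  rewrite <- (code_decode_list i), <- (code_decode_list j), !cnth_code_list.
  pose proof (length_le_code_list (decode_list i)).
  pose proof (length_le_code_list (decode_list j)). rewrite !code_decode_list in *.
  rewrite !nth_overflow by lia. rewrite qval_0. ring.
Qed.

Lemma sq_sum_l2_diff i j N : sq_sum (l2_diff i j) N <= sq_sum (l2_diff i j) (i + j).
Proof.
  unfold sq_sum. induction N as [|N IH].
  - destruct (i + j)%nat as [|K]; [apply Rle_refl|].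
    rewrite (decomp_sum _ (S K)) by lia. cbn [sum_f_R0 Nat.pred].
    pose proof (cond_pos_sum (fun n => l2_diff i j (S n) ^ 2) K (fun n => pow2_ge_0 _)). lra.
  - destruct (Nat.le_gt_cases (i + j) N) as [H|H].
    + cbn [sum_f_R0]. rewrite (l2_diff_zero i j (S N)) by lia. rewrite pow_i by lia. lra.
    + clear IH. remember (i + j)%nat as K eqn:EK. clear EK. induction H as [|K H IH].
      * apply Rle_refl.
      * cbn [sum_f_R0]. pose proof (pow2_ge_0 (l2_diff i j (S K))). cbn [sum_f_R0] in IH. lra.
Qed.

Lemma vdist_alpha_l2 i j :
  vdist (cb_alpha l2 i) (cb_alpha l2 j) = sqrt (sq_sum (l2_diff i j) (i + j)).
Proof.
  set (x := l2_add (cb_alpha l2 i) (l2_scal (-1) (cb_alpha l2 j))).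
  change (l2_norm x = sqrt (sq_sum (l2_diff i j) (i + j))).
  assert (E : co x = l2_diff i j).
  { apply functional_extensionality. intro n. unfold l2_diff. rewrite <- !co_alpha.
    reflexivity. }
  pose proof (sq_sum_nonneg (l2_diff i j) (i + j)) as H0.
  apply Rle_antisym.
  - apply l2_norm_le; [apply sqrt_pos|]. intro N. rewrite E, pow2_sqrt by exact H0.
    apply sq_sum_l2_diff.
  - rewrite <- (sqrt_pow2 (l2_norm x)) by apply l2_norm_nonneg.
    apply sqrt_le_1_alt. rewrite <- E. apply sq_sum_le_l2_norm.
Qed.

Lemma qval_nat a b : qval (to_nat (2 * a, b)%nat) = INR a / INR (S b).
Proof.
  unfold qval. rewrite Q2R_nat_to_Q, p1_to_nat, p2_to_nat, Nat.even_even.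
  now rewrite Nat.div2_double.
Qed.

Lemma INR_S_pow2_pred n : INR (S (2 ^ n - 1)) = 2 ^ n.
Proof.
  replace (S (2 ^ n - 1)) with (2 ^ n)%nat; [now rewrite pow_INR|].
  pose proof (Nat.pow_nonzero 2 n ltac:(lia)). lia.
Qed.

(** The squared norm is a supremum, so some partial sum comes within [(eps/2)^2] of it; the
    remainder after truncation at that index has partial sums below this difference. *)
Lemma l2_truncation_dense (x : l2car) eps :
  eps > 0 -> exists l : list R,
    vdist (V := l2_space) x (lincomb (V := l2_space) l2_basis 0 l) < eps.
Proof.
  intro He. destruct (l2_norm_lub x) as [Hub Hleast].
  assert (HK : exists K, l2_norm x ^ 2 - (eps / 2) ^ 2 < sq_sum (co x) K).
  { apply NNPP. intro Hn. assert (Hb : l2_norm x ^ 2 <= l2_norm x ^ 2 - (eps / 2) ^ 2).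
    { apply Hleast. intros r [N ->]. apply Rnot_lt_le. intro H. apply Hn. now exists N. }
    assert (0 < (eps / 2) ^ 2) by (apply pow_lt; lra). lra. }
  destruct HK as [K HK]. exists (map (co x) (seq 0 (S K))).
  apply Rle_lt_trans with (eps / 2); [|lra].
  set (y := lincomb _ _ _).
  change (l2_norm (l2_add x (l2_scal (-1) y)) <= eps / 2).
  assert (Hy : forall n, co (l2_add x (l2_scal (-1) y)) n
               = if (n <=? K)%nat then 0 else co x n).
  { intro n. transitivity (co x n + -1 * co y n); [reflexivity|].
    unfold y. rewrite co_lincomb. cbn [Nat.ltb Nat.leb]. rewrite Nat.sub_0_r.
    destruct (Nat.leb_spec n K) as [H|H].
    - rewrite (nth_indep _ 0 (co x 0)) by (rewrite length_map, length_seq; lia).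
      rewrite map_nth, seq_nth by lia. cbn [Nat.add]. ring.
    - rewrite nth_overflow by (rewrite length_map, length_seq; lia). ring. }
  apply l2_norm_le; [lra|]. intro N.
  assert (HN : sq_sum (co (l2_add x (l2_scal (-1) y))) N <=
               sq_sum (co x) (Nat.max N K) - sq_sum (co x) K).
  { assert (G : forall d, sq_sum (co (l2_add x (l2_scal (-1) y))) (K + d)
                  = sq_sum (co x) (K + d) - sq_sum (co x) K).
    { unfold sq_sum. induction d as [|d IH].
      - rewrite Nat.add_0_r, Rminus_diag. apply sum_eq_R0. intros n Hn. rewrite Hy.
        destruct (Nat.leb_spec n K); [simpl; ring|lia].
      - rewrite Nat.add_succ_r. cbn [sum_f_R0]. rewrite IH, Hy.
        destruct (Nat.leb_spec (S (K + d)) K); [lia|ring]. }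
    replace (Nat.max N K) with (K + (Nat.max N K - K))%nat by lia. rewrite <- G.
    replace (K + (Nat.max N K - K))%nat with (Nat.max N K) by lia.
    assert (Hle : (N <= Nat.max N K)%nat) by lia. revert Hle. generalize (Nat.max N K).
    unfold sq_sum. induction 1 as [|M _ IH]; [apply Rle_refl|]. cbn [sum_f_R0].
    match goal with |- _ <= _ + ?t ^ 2 => pose proof (pow2_ge_0 t) end. lra. }
  pose proof (sq_sum_le_l2_norm x (Nat.max N K)). lra.
Qed.

(** The dyadic number [m / 2^n] in the coding of [nat_to_Q]: the numerator is doubled to mark it as
    non-negative, and the denominator is stored minus 1. *)
Definition l2_dist_code (x : nat) : nat :=
  (let i := p1 x in let j := p1 (p2 x) in let n := p2 (p2 x) in
   let r := sum_frac i j (S (i + j)) in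
   to_nat (2 * sqrt_approx (p1 r) (p2 r) n, 2 ^ n - 1))%nat.

Lemma tr_sum_frac f g h :
  total_recursive f -> total_recursive g -> total_recursive h ->
  total_recursive (fun x => sum_frac (f x) (g x) (h x)).
Proof.
  intros Hf Hg Hh. unfold sum_frac.
  apply (tr_nat_rect (fun _ => to_nat (0, 1)%nat)
    (fun x s r => to_nat (p1 r * diff_den (cnth s (f x)) (cnth s (g x))
                          + diff_num (cnth s (f x)) (cnth s (g x)) * p2 r,
                          p2 r * diff_den (cnth s (f x)) (cnth s (g x))))%nat h); [tr_tac| |tr_tac].
  unfold diff_num, diff_den, qpos, qneg, qden. tr_tac.
Qed.

Lemma tr_l2_dist_code : total_recursive l2_dist_code.
Proof.
  unfold l2_dist_code, sqrt_approx.
  assert (H : total_recursive (fun x => sum_frac (p1 x) (p1 (p2 x)) (S (p1 x + p1 (p2 x))))).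
  { apply tr_sum_frac; tr_tac. }
  set (r := fun x => sum_frac _ _ _) in H.
  change (total_recursive (fun x => to_nat
    (2 * greatest (fun m => m * m * p2 (r x) - 4 ^ p2 (p2 x) * p1 (r x))
           (4 ^ p2 (p2 x) * p1 (r x)), 2 ^ p2 (p2 x) - 1)%nat)).
  clearbody r. apply tr_to_nat; [|tr_tac]. apply tr_mul; [tr_tac|].
  apply (tr_greatest (fun x m => (m * m * p2 (r x) - 4 ^ p2 (p2 x) * p1 (r x))%nat)
           (fun x => (4 ^ p2 (p2 x) * p1 (r x))%nat)); tr_tac.
Qed.

Theorem l2_is_CBS : is_CBS l2.
Proof.
  split; [exact l2_banach|]. split; [exact l2_truncation_dense|].
  exists l2_dist_code. split; [apply tr_l2_dist_code|]. intros i j n.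
  fold (qval (l2_dist_code (to_nat (i, to_nat (j, n))))).
  unfold l2_dist_code. rewrite !p2_to_nat, !p1_to_nat, qval_nat, INR_S_pow2_pred.
  rewrite vdist_alpha_l2. destruct (sum_frac_spec i j (i + j)) as [H1 H2].
  apply sqrt_approx_spec; [exact H1|apply sq_sum_nonneg|exact H2].
Qed.

(** * Choice on the natural numbers reduces to inversion on l2 *)

(* [changed p (cand p s)] is [0] when the candidate is refuted at stage [s]. *)
Definition changed (p : nat -> nat) (st : nat) : nat :=
  (p (p2 st) - S (p1 st) + (S (p1 st) - p (p2 st)))%nat.

(* State [<n, j>]: the candidate [n] has survived the comparison with
   [p 0, ..., p (j-1)]. *)
Definition cand (p : nat -> nat) (s : nat) : nat :=
  nat_rect (fun _ => nat) (to_nat (0, 0)%nat)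
    (fun _ st => ifz (changed p st) (to_nat (S (p1 st), 0)%nat)
                                    (to_nat (p1 st, S (p2 st)))) s.

Lemma cand_S p s :
  cand p (S s) = ifz (changed p (cand p s)) (to_nat (S (p1 (cand p s)), 0)%nat)
                   (to_nat (p1 (cand p s), S (p2 (cand p s)))).
Proof. reflexivity. Qed.

Lemma tr_changed p st :
  tr2 p -> total_recursive st -> total_recursive (fun x => changed (p x) (st x)).
Proof. intros Hp Hst. unfold changed. tr_tac. Qed.

Lemma tr_cand p s :
  tr2 p -> total_recursive s -> total_recursive (fun x => cand (p x) (s x)).
Proof.
  intros Hp Hs. unfold cand.
  apply (tr_nat_rect (fun _ => to_nat (0, 0)%nat)
    (fun x _ st => ifz (changed (p x) st) (to_nat (S (p1 st), 0)%nat)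
                                    (to_nat (p1 st, S (p2 st)))) s); [tr_tac| |tr_tac].
  unfold changed. tr_tac.
Qed.

Lemma changed_0 p st : changed p st = 0%nat <-> p (p2 st) = S (p1 st).
Proof. unfold changed. lia. Qed.

Lemma cand_le p s : (p2 (cand p s) <= s)%nat.
Proof.
  induction s as [|s IH]; [unfold cand; cbn [nat_rect]; rewrite p2_to_nat; lia|].
  rewrite cand_S. destruct (changed _ _); cbn [ifz]; rewrite p2_to_nat; lia.
Qed.

(** The comparison at a stage uses a position not exceeding that stage, so [s] stages read only
    [p 0, ..., p (s-1)] and can be run on a prefix. *)
Lemma cand_agree p q s :
  (forall c, (c < s)%nat -> p c = q c) -> cand p s = cand q s.
Proof.
  induction s as [|s IH]; intro H; [reflexivity|].
  rewrite !cand_S. rewrite <- IH by (intros; apply H; lia).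
  unfold changed. pose proof (cand_le p s). rewrite H by lia. reflexivity.
Qed.

Lemma cand_survived p s j : (j < p2 (cand p s))%nat -> p j <> S (p1 (cand p s)).
Proof.
  induction s as [|s IH]; [unfold cand; cbn [nat_rect]; rewrite p2_to_nat; lia|].
  rewrite cand_S. destruct (changed _ _) eqn:E; cbn [ifz]; rewrite p1_to_nat, p2_to_nat;
    [lia|]. intro Hj. destruct (Nat.eq_dec j (p2 (cand p s))) as [->|].
  - intro H. apply changed_0 in H. congruence.
  - apply IH. lia.
Qed.

(** The candidate moves up by 1 at a time and would stay at [m] forever. *)
Lemma cand_bounded p m s :
  (forall k, p k <> S m) -> (p1 (cand p s) <= m)%nat.
Proof.
  intro Hm. induction s as [|s IH]; [unfold cand; cbn [nat_rect]; rewrite p1_to_nat; lia|].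
  rewrite cand_S. destruct (changed _ _) eqn:E; cbn [ifz]; rewrite p1_to_nat; [|exact IH].
  apply changed_0 in E. destruct (Nat.eq_dec (p1 (cand p s)) m) as [e|]; [|lia].
  rewrite e in E. now elim (Hm (p2 (cand p s))).
Qed.

Lemma cand_mono p s t : (s <= t)%nat -> (p1 (cand p s) <= p1 (cand p t))%nat.
Proof.
  induction 1 as [|t _ IH]; [lia|]. rewrite cand_S.
  destruct (changed _ _); cbn [ifz]; rewrite p1_to_nat; lia.
Qed.

(** Every refutation raises the candidate, which cannot pass [m]; the induction is on the distance
    [d] that is left. *)
Lemma cand_eventually_stable p m :
  (forall k, p k <> S m) ->
  exists s0, forall s, (s0 <= s)%nat -> changed p (cand p s) <> 0%nat.
Proof.
  intro Hm.
  assert (G : forall d s, (m <= p1 (cand p s) + d)%nat ->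
            exists s0, forall t, (s0 <= t)%nat -> changed p (cand p t) <> 0%nat).
  { induction d as [|d IH]; intros s Hs;
      destruct (classic (exists t, (s <= t)%nat /\ changed p (cand p t) = 0%nat))
        as [(t & Ht & E)|Hno];
      try (exists s; intros t Ht E; apply Hno; now exists t);
      pose proof (cand_mono p s t Ht) as Hst;
      assert (Ht1 : p1 (cand p (S t)) = S (p1 (cand p t)))
        by (rewrite cand_S, E; apply p1_to_nat).
    - pose proof (cand_bounded p m (S t) Hm). lia.
    - apply (IH (S t)). lia. }
  apply (G m 0%nat). lia.
Qed.

(** From stage [L] on, the position of comparison advances at every stage and thus meets every later
    [k]; the earlier positions were passed before. *)
Lemma cand_stable p L :
  (forall s, (L <= s)%nat -> changed p (cand p s) <> 0%nat) ->
  forall k, p k <> S (p1 (cand p L)).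
Proof.
  intros H k.
  assert (G : forall d, p1 (cand p (L + d)) = p1 (cand p L) /\
                        p2 (cand p (L + d)) = (p2 (cand p L) + d)%nat).
  { induction d as [|d [IH1 IH2]]; [now rewrite !Nat.add_0_r|].
    rewrite Nat.add_succ_r, cand_S. specialize (H (L + d)%nat ltac:(lia)).
    destruct (changed _ _); [contradiction|]. cbn [ifz]. rewrite p1_to_nat, p2_to_nat. lia. }
  destruct (Nat.lt_ge_cases k (p2 (cand p L))) as [Hk|Hk]; [now apply cand_survived|].
  destruct (G (k - p2 (cand p L))%nat) as [E1 E2].
  specialize (H (L + (k - p2 (cand p L)))%nat ltac:(lia)). intro E. apply H, changed_0.
  rewrite E1, E2, <- E. f_equal. lia.
Qed.

(** Only denominators change, so the image of a finite rational sequence is again one and its code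
    is computed exactly. The final subtraction fits the coding of denominators minus 1. *)
Definition scale_code (p : nat -> nat) (c : nat) : nat :=
  (cmk (fun s => ifz (changed p (cand p s))
                   (to_nat (p1 (cnth s c), S (p2 (cnth s c)) * 2 ^ S s - 1))
                   (cnth s c)) (clen c))%nat.

(** Position [n] of the output needs only position [n] of the input: the operator is a contraction,
    so applying it termwise preserves the rate of a Cauchy name. *)
Definition diag_name (N cu : nat) : nat :=
  ifz (S (p1 N) - clen (p2 N))
    (S (scale_code (fun c => cnth c cu) (cnth (p1 N) (p2 N)))) 0.

Lemma tr_diag_name : tr2 diag_name.
Proof.
  unfold tr2, diag_name.
  assert (H : total_recursive (fun z =>
    scale_code (fun c => cnth c (p2 z)) (cnth (p1 (p1 z)) (p2 (p1 z))))).
  { unfold scale_code.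
    assert (Hc : total_recursive (fun z => cand (fun c => cnth c (p2 (p1 z))) (p2 z)))
      by (apply (tr_cand (fun z c => cnth c (p2 (p1 z))) p2); tr_tac).
    assert (Hc' : total_recursive (fun z => changed (fun c => cnth c (p2 (p1 z)))
                    (cand (fun c => cnth c (p2 (p1 z))) (p2 z))))
      by (apply (tr_changed (fun z c => cnth c (p2 (p1 z)))); [tr_tac|exact Hc]).
    apply (tr_cmk (fun z s =>
      ifz (changed (fun c => cnth c (p2 z)) (cand (fun c => cnth c (p2 z)) s))
      (to_nat (p1 (cnth s (cnth (p1 (p1 z)) (p2 (p1 z)))),
         S (p2 (cnth s (cnth (p1 (p1 z)) (p2 (p1 z))))) * 2 ^ S s - 1))
      (cnth s (cnth (p1 (p1 z)) (p2 (p1 z)))))%nat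
      (fun z => clen (cnth (p1 (p1 z)) (p2 (p1 z))))); [|tr_tac].
    unfold tr2. apply tr_ifz; [exact Hc'|tr_tac|tr_tac]. }
  apply tr_ifz; [tr_tac|now apply tr_succ|tr_tac].
Qed.

Definition weight (p : nat -> nat) (s : nat) : R :=
  if Nat.eq_dec (changed p (cand p s)) 0 then (/ 2) ^ S s else 1.

Lemma weight_bounds p s : 0 < weight p s <= 1.
Proof.
  unfold weight. destruct (Nat.eq_dec _ _); [|lra]. split; [apply pow_half_pos|].
  rewrite <- (pow1 (S s)). apply pow_incr. lra.
Qed.

Lemma qval_scale a s :
  qval (to_nat (p1 a, S (p2 a) * 2 ^ S s - 1))%nat = (/ 2) ^ S s * qval a.
Proof.
  unfold qval. rewrite !Q2R_nat_to_Q, p1_to_nat, p2_to_nat.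
  replace (S (S (p2 a) * 2 ^ S s - 1)) with (S (p2 a) * 2 ^ S s)%nat
    by (pose proof (Nat.pow_nonzero 2 (S s) ltac:(lia)); nia).
  rewrite mult_INR, pow_INR, pow_inv. change (INR 2) with 2.
  set (v := if Nat.even _ then _ else _). pose proof (INR_S_pos (p2 a)).
  assert (0 < 2 ^ S s) by (apply pow_lt; lra). field. lra.
Qed.

Lemma cnth_cmk g L n : cnth n (cmk g L) = if (n <? L)%nat then g n else 0%nat.
Proof. rewrite cmk_prefix, cnth_code_list. apply nth_prefix. Qed.

Lemma cnth_overflow n c : (clen c <= n)%nat -> cnth n c = 0%nat.
Proof.
  rewrite <- (code_decode_list c), clen_code_list, cnth_code_list. apply nth_overflow.
Qed.

Lemma clen_le c : (clen c <= c)%nat.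
Proof.
  rewrite <- (code_decode_list c) at 1. rewrite clen_code_list.
  pose proof (length_le_code_list (decode_list c)). now rewrite code_decode_list in *.
Qed.

Lemma qval_scale_code p c n :
  qval (cnth n (scale_code p c)) = weight p n * qval (cnth n c).
Proof.
  unfold scale_code, weight. rewrite cnth_cmk. destruct (Nat.ltb_spec n (clen c)) as [H|H].
  - destruct (Nat.eq_dec _ _) as [E|E].
    + rewrite E. cbn [ifz]. apply qval_scale.
    + destruct (changed _ _); [contradiction|]. cbn [ifz]. ring.
  - rewrite (cnth_overflow n c H), qval_0. ring.
Qed.

Lemma scale_code_agree p q c :
  (forall i, (i < clen c)%nat -> p i = q i) -> scale_code p c = scale_code q c.
Proof.
  intro H. unfold scale_code. rewrite !cmk_spec. f_equal. apply map_ext_in.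
  intros s Hs. apply in_seq in Hs.
  rewrite <- (cand_agree p q s) by (intros; apply H; lia).
  unfold changed. rewrite <- H by (pose proof (cand_le p s); lia). reflexivity.
Qed.

(** * Diagonal operators *)

Lemma sq_summable_mult (c : nat -> R) M (x : l2car) :
  (forall n, Rabs (c n) <= M) -> sq_summable (fun n => c n * co x n).
Proof.
  intro H. destruct (sq_summable_scal M _ (proj2_sig x)) as [B HB]. exists B. intro N.
  eapply Rle_trans; [|apply (HB N)].
  apply (sq_sum_le (fun n => c n * co x n) (fun n => M * proj1_sig x n)). intro n.
  rewrite !Rabs_mult. apply Rmult_le_compat_r; [apply Rabs_pos|].
  eapply Rle_trans; [apply H|apply Rle_abs].
Qed.

Definition diag (c : nat -> R) M (H : forall n, Rabs (c n) <= M) (x : l2car) : l2car :=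
  exist _ _ (sq_summable_mult c M x H).

Lemma l2_norm_diag c M H x : l2_norm (diag c M H x) <= M * l2_norm x.
Proof.
  assert (HM : 0 <= M) by (eapply Rle_trans; [apply Rabs_pos|apply (H 0%nat)]).
  apply Rle_trans with (Rabs M * l2_norm x); [|rewrite Rabs_right by lra; apply Rle_refl].
  rewrite <- l2_norm_scal. apply l2_norm_mono. intro n.
  change (Rabs (c n * co x n) <= Rabs (M * co x n)). rewrite !Rabs_mult.
  apply Rmult_le_compat_r; [apply Rabs_pos|]. rewrite (Rabs_right M) by lra. apply H.
Qed.

Lemma diag_linear c M H : linear_map (V := l2_space) (W := l2_space) (diag c M H).
Proof.
  split; intros; apply l2_ext; intro n; unfold co; cbn; unfold co; cbn; ring.
Qed.

Lemma weight_le_1 p n : Rabs (weight p n) <= 1.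
Proof.
  destruct (weight_bounds p n). rewrite Rabs_right; lra.
Qed.

Definition weight_op (p : Baire) : cb_sp l2 -> cb_sp l2 := diag (weight p) 1 (weight_le_1 p).

Lemma weight_op_alpha p c : weight_op p (cb_alpha l2 c) = cb_alpha l2 (scale_code p c).
Proof.
  apply l2_ext. intro n. rewrite co_alpha, qval_scale_code, <- co_alpha. reflexivity.
Qed.

Lemma weight_op_contraction p (x y : cb_sp l2) :
  vdist (weight_op p x) (weight_op p y) <= vdist x y.
Proof.
  destruct (diag_linear (weight p) 1 (weight_le_1 p)) as [Ha Hs].
  change (l2_norm (l2_add (weight_op p x) (l2_scal (-1) (weight_op p y)))
          <= l2_norm (l2_add x (l2_scal (-1) y))).
  replace (l2_add (weight_op p x) _) with (weight_op p (l2_add x (l2_scal (-1) y))).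
  - rewrite <- Rmult_1_l. apply l2_norm_diag.
  - transitivity (l2_add (weight_op p x) (weight_op p (l2_scal (-1) y))); [apply Ha|].
    f_equal. apply (Hs (-1) y).
Qed.

Lemma diag_name_correct p : names (prefix_op diag_name p) (weight_op p).
Proof.
  intros q x [Hq1 Hq2]. exists (fun n => scale_code p (q n)). split.
  - intro n. exists (S n).
    assert (E : forall m, prefix_op diag_name p (code_nw n (prefix q m))
                = if (n <? m)%nat then S (scale_code p (q n)) else 0%nat).
    { intro m. unfold prefix_op, diag_name. set (N := code_nw n (prefix q m)).
      assert (E1 : p1 N = n) by apply p1_to_nat.
      assert (E2 : p2 N = code_list (prefix q m)) by apply p2_to_nat.
      rewrite E1, E2, clen_code_list, length_prefix, cnth_code_list, nth_prefix.
      destruct (Nat.ltb_spec n m) as [H|H].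
      - replace (S n - m)%nat with 0%nat by lia. cbn [ifz]. f_equal.
        (* The index [N] codes a prefix that contains [q n], so [clen (q n) <= q n <= N] and the
           visible part of [p] is long enough. *)
        apply scale_code_agree. intros i Hi. destruct (truncation_prefix p (2 * N + 2)) as [Ht _].
        apply Ht. pose proof (clen_le (q n)).
        pose proof (nth_le_code_list n (prefix q m)) as Hn. rewrite nth_prefix in Hn.
        destruct (Nat.ltb_spec n m); [|lia].
        pose proof (to_nat_ge2 n (code_list (prefix q m))) as Hc.
        unfold N, code_nw. lia.
      - replace (S n - m)%nat with (S (n - m)) by lia. reflexivity. }
    split; [|split].
    + rewrite E. destruct (Nat.ltb_spec n (S n)); [discriminate|lia].
    + intros m Hm. rewrite E. destruct (Nat.ltb_spec n m); [lia|reflexivity].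
    + rewrite E. destruct (Nat.ltb_spec n (S n)); [reflexivity|lia].
  - split.
    + intros i j Hij. rewrite <- !weight_op_alpha.
      eapply Rle_trans; [apply weight_op_contraction|now apply Hq1].
    + intros eps He. destruct (Hq2 eps He) as [N HN]. exists N. intros n Hn.
      rewrite <- weight_op_alpha.
      eapply Rle_lt_trans; [apply weight_op_contraction|now apply HN].
Qed.

(** All refutations occur before some stage [s0], so every diagonal entry is at least [2^-s0] and
    the reciprocals define a bounded operator. *)
Lemma weight_op_invertible p m :
  (forall k, p k <> S m) ->
  exists S0 : cb_sp l2 -> cb_sp l2, IMT l2 l2 (weight_op p) S0.
Proof.
  intro Hm. destruct (cand_eventually_stable p m Hm) as [s0 Hs0].
  assert (Hinv : forall n, Rabs (/ weight p n) <= 2 ^ s0).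
  { intro n. destruct (weight_bounds p n) as [H _].
    rewrite Rabs_right by (left; now apply Rinv_0_lt_compat).
    unfold weight. destruct (Nat.eq_dec _ _) as [E|E].
    - rewrite pow_inv, Rinv_inv. apply Rle_pow; [lra|].
      destruct (Nat.le_gt_cases s0 n) as [Hn|Hn]; [|lia]. now elim (Hs0 n Hn).
    - rewrite Rinv_1. apply pow_R1_Rle. lra. }
  assert (HTS : forall y, weight_op p (diag _ _ Hinv y) = y).
  { intro y. apply l2_ext. intro n.
    change (weight p n * (/ weight p n * co y n) = co y n).
    destruct (weight_bounds p n). field. lra. }
  destruct (diag_linear (weight p) 1 (weight_le_1 p)) as [Ha Hs].
  exists (diag _ _ Hinv). split; [|exact HTS].
  split; [exact Ha|]. split; [exact Hs|]. split; [|split].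
  - exists 1. exact (l2_norm_diag _ _ _).
  - intros x y E. apply l2_ext. intro n. apply (f_equal (fun z => co z n)) in E.
    change (weight p n * co x n = weight p n * co y n) in E.
    apply Rmult_eq_reg_l in E; [exact E|]. destruct (weight_bounds p n). lra.
  - intro y. eexists. apply HTS.
Qed.

(** The pair codes the rational [1 / 2^s]. After [n + 2] coordinates the squared norm of the
    remainder is below [4^-(n+1)], the precision asked for by [cauchy_rep_intro]. *)
Definition geom_name (n : nat) : nat := cmk (fun s => to_nat (2, 2 ^ s - 1))%nat (S (S n)).

Lemma pow2_half n : ((/ 2) ^ n) ^ 2 = (/ 4) ^ n.
Proof.
  rewrite <- pow_mult, Nat.mul_comm, pow_mult. f_equal. field.
Qed.

Lemma geom_sq_summable : sq_summable (fun n => (/ 2) ^ n).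
Proof.
  exists 2. intro N. assert (H : sum_f_R0 (fun n => ((/ 2) ^ n) ^ 2) N <= 2 - (/ 4) ^ N).
  { induction N as [|N IH]; [simpl; lra|]. cbn [sum_f_R0]. rewrite pow2_half.
    assert (0 < (/ 4) ^ N) by (apply pow_lt; lra). simpl pow in *. lra. }
  assert (0 < (/ 4) ^ N) by (apply pow_lt; lra). lra.
Qed.

Definition geom : cb_sp l2 := exist _ _ geom_sq_summable.

Lemma geom_name_correct : cauchy_rep l2 geom_name geom.
Proof.
  apply cauchy_rep_intro; [apply l2_banach|]. intro n.
  set (x := l2_add (cb_alpha l2 (geom_name n)) (l2_scal (-1) geom)).
  change (l2_norm x <= (/ 2) ^ S n).
  assert (Hx : forall s, co x s ^ 2 = if (s <? S (S n))%nat then 0 else (/ 4) ^ s).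
  { intro s. transitivity ((co (cb_alpha l2 (geom_name n)) s + -1 * (/ 2) ^ s) ^ 2);
      [reflexivity|].
    rewrite co_alpha. unfold geom_name. rewrite cnth_cmk.
    destruct (Nat.ltb_spec s (S (S n))).
    - change 2%nat with (2 * 1)%nat at 1. rewrite qval_nat, INR_S_pow2_pred.
      rewrite pow_inv. change (INR 1) with 1. unfold Rdiv. ring.
    - rewrite qval_0, <- pow2_half. ring. }
  apply l2_norm_le; [left; apply pow_half_pos|]. intro N. rewrite pow2_half.
  (* The subtracted term pays for the next summand in the induction. *)
  assert (H : sq_sum (co x) N <= (/ 4) ^ S n - (/ 4) ^ Nat.max N (S n)).
  { unfold sq_sum. induction N as [|N IH].
    - cbn [sum_f_R0]. rewrite Hx. cbn [Nat.ltb Nat.leb Nat.max]. lra.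
    - cbn [sum_f_R0]. rewrite Hx. destruct (Nat.ltb_spec (S N) (S (S n))) as [Hl|Hl].
      + replace (Nat.max (S N) (S n)) with (S n) by lia.
        replace (Nat.max N (S n)) with (S n) in IH by lia. lra.
      + replace (Nat.max (S N) (S n)) with (S N) by lia.
        replace (Nat.max N (S n)) with N in IH by lia.
        assert (0 < (/ 4) ^ N) by (apply pow_lt; lra). simpl pow in *. lra. }
  assert (0 < (/ 4) ^ Nat.max N (S n)) by (apply pow_lt; lra). lra.
Qed.

(* Searches for [eta sigma geom_name 0], the code of an approximation of [T^-1 geom],
   in a prefix of [bpair p sigma], and returns the candidate at the stage given by the
   number of coordinates of that approximation. *)
Definition element_name (x : nat) : nat :=
  let cu := p2 x in
  let e := peval (fun c => cnth (S (2 * c)) cu) geom_name 0 (clen cu) in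
  ifz e 0 (ifz (2 * clen (Nat.pred e) - clen cu)
             (S (p1 (cand (fun c => cnth (2 * c)%nat cu) (clen (Nat.pred e))))) 0).

Lemma tr_element_name : total_recursive element_name.
Proof.
  unfold element_name.
  assert (H : total_recursive (fun x =>
     peval (fun c => cnth (S (2 * c)) (p2 x)) geom_name 0 (clen (p2 x)))).
  { apply (tr_peval (fun x c => cnth (S (2 * c)) (p2 x)) (fun _ => geom_name)
             (fun _ => 0%nat) (fun x => clen (p2 x))); unfold geom_name; tr_tac. }
  set (e := fun x => peval _ _ _ _) in H.
  assert (Hc : total_recursive (fun x =>
     cand (fun c => cnth (2 * c)%nat (p2 x)) (clen (Nat.pred (e x))))).
  { clearbody e. apply (tr_cand (fun x c => cnth (2 * c)%nat (p2 x))); tr_tac. }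
  change (total_recursive (fun x => ifz (e x) 0
    (ifz (2 * clen (Nat.pred (e x)) - clen (p2 x))
      (S (p1 (cand (fun c => cnth (2 * c)%nat (p2 x)) (clen (Nat.pred (e x)))))) 0))).
  set (u := fun x => cand _ _) in Hc.
  change (total_recursive (fun x => ifz (e x) 0
    (ifz (2 * clen (Nat.pred (e x)) - clen (p2 x)) (S (p1 (u x))) 0))).
  clearbody u e. tr_tac.
Qed.

Lemma bpair_odd p s c : bpair p s (S (2 * c))%nat = s c.
Proof.
  unfold bpair. replace (S (2 * c)) with (2 * c + 1)%nat by lia.
  rewrite Nat.even_odd. f_equal. rewrite Nat.add_1_r, Nat.div2_succ_double. reflexivity.
Qed.

Lemma truncation_bpair_odd p s m :
  truncation s (fun c => cnth (S (2 * c)) (code_list (prefix (bpair p s) m))) (Nat.div2 m).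
Proof.
  pose proof (Nat.div2_odd m) as E. destruct (Nat.odd m); cbn [Nat.b2n] in E;
  split; intros c Hc; rewrite cnth_code_list, nth_prefix;
    destruct (Nat.ltb_spec (S (2 * c)) m); try lia; try reflexivity; apply bpair_odd.
Qed.

(** All prefixes that give an answer give the same one: evaluation on a part of [s] is sound, and
    the test that [2 L] entries are present guarantees that [p 0, ..., p (L-1)] are visible, which
    fixes the candidate at stage [L]. *)
Lemma element_name_correct p s r :
  eta s geom_name r ->
  exists q, eta element_name (bpair p s) q /\
            forall n, q n = p1 (cand p (clen (r 0%nat))).
Proof.
  intro Hr. set (L := clen (r 0%nat)).
  assert (Hsound : forall n m, element_name (code_nw n (prefix (bpair p s) m)) <> 0%nat ->
            element_name (code_nw n (prefix (bpair p s) m)) = S (p1 (cand p L))).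
  { intros n m. unfold element_name, code_nw.
    rewrite p2_to_nat, clen_code_list, length_prefix. cbv zeta.
    pose proof (peval_sound s _ _ geom_name r 0 m (truncation_bpair_odd p s m) Hr) as He.
    set (e := peval _ _ _ _) in *.
    destruct e as [|j]; cbn [ifz]; [contradiction|].
    specialize (He ltac:(discriminate)). injection He as ->. cbn [Nat.pred]. fold L.
    destruct (2 * L - m)%nat eqn:E; cbn [ifz]; [|contradiction]. intros _. do 2 f_equal.
    apply cand_agree. intros c Hc. rewrite cnth_code_list, nth_prefix.
    destruct (Nat.ltb_spec (2 * c) m)%nat; [apply bpair_even|lia]. }
  assert (Hcomplete : forall n, exists m,
            element_name (code_nw n (prefix (bpair p s) m)) <> 0%nat).
  { intro n. destruct (peval_complete s geom_name r 0 Hr) as [t0 Ht0].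
    set (m := (2 * (t0 + L))%nat). exists m. unfold element_name, code_nw.
    rewrite p2_to_nat, clen_code_list, length_prefix. cbv zeta.
    rewrite (Ht0 m _ _ (truncation_bpair_odd p s m)).
    - cbn [ifz Nat.pred]. fold L. replace (2 * L - m)%nat with 0%nat by lia. discriminate.
    - lia.
    - unfold m. rewrite Nat.div2_double. lia. }
  destruct (eta_defined _ _ Hcomplete) as [q Hq]. exists q. split; [exact Hq|]. intro n.
  destruct (eta_value _ _ _ n Hq) as [m Hm]. rewrite Hsound in Hm; [congruence|].
  rewrite Hm. discriminate.
Qed.

(* At a change [s] the vector [T^-1 geom] has coordinate [2^-s / 2^-(s+1) = 2], so it is
   at distance at least [2] from any vector with vanishing coordinate [s]. *)
Lemma no_change_beyond p (x : cb_sp l2) r s :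
  weight_op p x = geom -> cauchy_rep l2 r x ->
  (clen (r 0%nat) <= s)%nat -> changed p (cand p s) <> 0%nat.
Proof.
  intros Hx Hr Hs E. apply (f_equal (fun z => co z s)) in Hx.
  change (weight p s * co x s = (/ 2) ^ s) in Hx. unfold weight in Hx.
  rewrite E in Hx. cbn [Nat.eq_dec nat_rec nat_rect] in Hx.
  pose proof (cauchy_rep_dist l2 l2_banach r x 0 Hr) as Hd. simpl pow in Hd.
  pose proof (co_le_l2_norm (l2_add (cb_alpha l2 (r 0%nat)) (l2_scal (-1) x)) s) as Hc.
  change (co (l2_add ?a ?b) ?c) with (co a c + co b c) in Hc.
  change (co (l2_scal ?a ?b) ?c) with (a * co b c) in Hc.
  rewrite co_alpha, cnth_overflow, qval_0 in Hc by exact Hs.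
  change (l2_norm _) with (vdist (cb_alpha l2 (r 0%nat)) x) in Hc.
  apply Rabs_le_bounds in Hc. pose proof (pow_half_pos s). simpl pow in Hx.
  assert (co x s = 2); [|lra].
  apply Rmult_eq_reg_l with (/ 2 * (/ 2) ^ s); [lra|]. lra.
Qed.

Theorem CN_le_IMT_l2 : weih_le CN (IMT l2 l2).
Proof.
  (* The first functional is not a [prefix_op]: how much of a name of the inverse has to be read is
     not known in advance. *)
  exists (eta element_name), (fun p r => r = prefix_op diag_name p).
  split; [exists element_name; split; [exact tr_element_name|auto]|].
  split; [apply computable_prefix_op, tr_diag_name|].
  intros G [Gfun HG]. split.
  - intros p q q' (k & s & -> & Hs & H) (k' & s' & -> & Hs' & H').
    rewrite (Gfun _ _ _ Hs Hs') in H. exact (eta_functional _ _ _ _ H H').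
  - intros p A HA [m0 [[m Hm] _]].
    assert (Hpm : forall k, p k <> S m).
    { intros k E. assert (A m = false) by (apply HA; now exists k). congruence. }
    destruct (HG _ _ (diag_name_correct p) (weight_op_invertible p m Hpm)) as [[s Hs] Hall].
    destruct (Hall s Hs) as (S0 & HS0 & _ & HT).
    destruct (HS0 _ _ geom_name_correct) as (r & Hr & Hc).
    destruct (element_name_correct p s r Hr) as (q & Hq & Eq). split.
    + exists q, (prefix_op diag_name p), s. auto.
    + intros q' (k & s' & -> & Hs' & Hq').
      rewrite (Gfun _ _ _ Hs' Hs) in Hq'. rewrite (eta_functional _ _ _ _ Hq' Hq).
      exists (q 0%nat). split; [reflexivity|]. split; [now exists m|].
      rewrite Eq. destruct (A (p1 _)) eqn:EA; [reflexivity|]. exfalso.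
      apply HA in EA as [k Hk]. revert Hk. apply cand_stable. intros t Ht.
      exact (no_change_beyond p _ r t (HT geom) Hc Ht).
Qed.

Theorem theorem5p3 (X Y : CBSpace) (HX : is_CBS X) (HY : is_CBS Y) :
  weih_le (IMT X Y) CN /\ weih_eq CN (IMT l2 l2).
Proof.
  split; [exact (IMT_le_CN X Y HX HY)|].
  split; [exact CN_le_IMT_l2|exact (IMT_le_CN l2 l2 l2_is_CBS l2_is_CBS)].
Qed.
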